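(* For every $f\in L^1(\mathbb S^2)$, the semicircle transforms of measures and of functions satisfy $$\mathcal W[f\sigma_{\mathbb S^2}]=(\mathcal Wf)\,\sigma_{\mathrm{SO}(3)}\qquad\text{and}\qquad\mathcal W_{\alpha,\beta}[f\sigma_{\mathbb S^2}]=(\mathcal W_{\alpha,\beta}f)\,\sigma_{\mathbb T}\quad(\alpha\in\mathbb T,\ \beta\in[0,\pi]).$$ In particular, the transformed measures are again absolutely continuous.
   Context: $\mathbb S^2\subset\mathbb R^3$ is the unit sphere with surface measure $\sigma_{\mathbb S^2}$ and uniform measure $u_{\mathbb S^2}=(4\pi)^{-1}\sigma_{\mathbb S^2}$; $\mathbb T=\mathbb R/(2\pi\mathbb Z)$ with Lebesgue measure $\sigma_{\mathbb T}$ (mass $2\pi$). $\mathcal M(X)$ denotes finite signed Borel measures on $X$; $h\sigma$ is the measure with density $h$ w.r.t. $\sigma$; $T_\#\mu=\mu\circ T^{-1}$. $\Phi(\varphi,\vartheta)=(\cos\varphi\sin\vartheta,\sin\varphi\sin\vartheta,\cos\vartheta)$; the azimuth $\mathrm{azi}(\xi)\in\mathbb T$ is given by $\mathrm{azi}(\Phi(\varphi,\vartheta))=\varphi$ for $\vartheta\in(0,\pi)$ and $\mathrm{azi}=0$ at the poles. Euler angles: $\Psi(\alpha,\beta,\gamma)=R_3(\alpha)R_2(\beta)R_3(\gamma)\in\mathrm{SO}(3)$, $\alpha,\gamma\in\mathbb T$, $\beta\in[0,\pi]$, with $$R_3(\alpha)=\begin{pmatrix}\cos\alpha&-\sin\alpha&0\\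 \sin\alpha&\cos\alpha&0\\0&0&1\end{pmatrix},\quad R_2(\beta)=\begin{pmatrix}\cos\beta&0&\sin\beta\\0&1&0\\-\sin\beta&0&\cos\beta\end{pmatrix}.$$ $\sigma_{\mathrm{SO}(3)}$ is the invariant measure $\int f\,d\sigma_{\mathrm{SO}(3)}=\int_0^{2\pi}\int_0^\pi\int_0^{2\pi}f(\Psi(\alpha,\beta,\gamma))\sin\beta\,d\alpha\,d\beta\,d\gamma$. Azimuth operator: $\mathcal A_{\alpha,\beta}(\xi)=\mathrm{azi}(\Psi(\alpha,\beta,0)^\top\xi)$. Transforms of functions (defined almost everywhere for $f\in L^1(\mathbb S^2)$): $\mathcal Wf(Q)=\frac1{4\pi}\int_0^\pi f(Q\,\Phi(0,\vartheta))\sin\vartheta\,d\vartheta$ for $Q\in\mathrm{SO}(3)$, and $\mathcal W_{\alpha,\beta}f(\gamma)=4\pi\,\mathcal Wf(\Psi(\alpha,\beta,\gamma))=\int_0^\pi f(\Psi(\alpha,\beta,0)\Phi(\gamma,\vartheta))\sin\vartheta\,d\vartheta$ for $\gamma\in\mathbb T$. Transforms of measures: for $\mu\in\mathcal M(\mathbb S^2)$, $\mathcal W_{\alpha,\beta}\mu=(\mathcal A_{\alpha,\beta})_\#\mu\in\mathcal M(\mathbb T)$ and $\mathcal W\mu=(T_{\mathcal W})_\#(u_{\mathbb S^2}\times\mu)\in\mathcal M(\mathrm{SO}(3))$ with $T_{\mathcal W}(\Phi(\alpha,\beta),\xi)=\Psi(\alpha,\beta,\mathcal A_{\alpha,\beta}(\xi))$.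 *)

(* Defs.v *)
From HB Require Import structures.
From mathcomp Require Import all_boot all_order all_algebra.
From mathcomp Require Import ring lra.
From mathcomp Require Import all_classical all_reals all_analysis.
From mathcomp Require Import measurable_realfun.
Import Order.TTheory GRing.Theory Num.Theory.
Import numFieldNormedType.Exports.

Set Implicit Arguments.
Unset Strict Implicit.
Unset Printing Implicit Defensive.

Local Open Scope classical_set_scope.
Local Open Scope ring_scope.

Section circle.
Local Open Scope quotient_scope.
Variable R : realType.

Definition equiv_2pi (x y : R) : bool :=
  `[< exists k : int, x - y = 2 * pi * k%:~R >].

Lemma equiv_2pi_refl : reflexive equiv_2pi.
Proof. by move=> x; apply/asboolP; exists 0; rewrite subrr mulr0. Qed.

Lemma equiv_2pi_sym : symmetric equiv_2pi.
Proof.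
by move=> x y; apply/asboolP/asboolP => -[k e]; exists (- k);
  rewrite rmorphN mulrN -e opprB.
Qed.

Lemma equiv_2pi_trans : transitive equiv_2pi.
Proof.
move=> y x z /asboolP[k e] /asboolP[l e']; apply/asboolP; exists (k + l).
by rewrite rmorphD mulrDr -e -e' addrA subrK.
Qed.

Canonical equiv_2pi_rel := EquivRel equiv_2pi
  equiv_2pi_refl equiv_2pi_sym equiv_2pi_trans.

(* R / 2 pi Z with the quotient topology; as for S2 and SO3 below, the
   measurable sets are the Borel sets *)
Definition circle : Type := quotient_topology {eq_quot equiv_2pi_rel}.

HB.instance Definition _ :=
  Quotient.copy circle (quotient_topology {eq_quot equiv_2pi_rel}).
HB.instance Definition _ :=
  PointedTopological.copy circle (quotient_topology {eq_quot equiv_2pi_rel}).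
HB.instance Definition _ :=
  Measurable.copy circle (g_sigma_algebraType (@open circle)).

Definition angle (t : R) : circle := \pi_circle t.
Definition cosT (a : circle) : R := cos (repr a).
Definition sinT (a : circle) : R := sin (repr a).

Lemma angleP (s t : R) : reflect (angle s = angle t) (equiv_2pi s t).
Proof. exact: (eqmodP equiv_2pi_rel). Qed.

Lemma angle_repr (a : circle) : angle (repr a) = a.
Proof. exact: reprK. Qed.

Lemma cos_sin_equiv_2pi (s t : R) :
  equiv_2pi s t <-> cos s = cos t /\ sin s = sin t.
Proof.
split=> [/asboolP[k e]|[ec es]].
  have H (u : R) (n : nat) :
      cos (u + (2 * pi) * n%:R) = cos u /\ sin (u + (2 * pi) * n%:R) = sin u.
    rewrite mulr_natr mulr_natl; split.
      exact: (periodicn (@cosD2pi R)).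
    exact: (periodicn (@sinD2pi R)).
  have {e}-> : s = t + 2 * pi * k%:~R by rewrite -e addrC subrK.
  case: k => n; first exact: H.
  rewrite NegzE rmorphN mulrN/=.
  by have [<- <-] := H (t - 2 * pi * n.+1%:R) n.+1; rewrite subrK.
have p0 : 0 < 2 * pi :> R by rewrite mulr_gt0// pi_gt0.
pose k : int := Num.floor ((s - t) / (2 * pi)).
pose u := s - t - 2 * pi * k%:~R.
have /andP[u0 u2] : 0 <= u < 2 * pi.
  have /andP[] := floor_itv ((s - t) / (2 * pi)); rewrite -/k.
  rewrite ler_pdivlMr// ltr_pdivrMr// rmorphD/= mulrDl mul1r => h1 h2.
  by rewrite /u; apply/andP; split; lra.
have cosu : cos u = 1.
  have {}ec : cos (s - t) = 1 by rewrite cosB ec es -!expr2 cos2Dsin2.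
  rewrite -ec.
  have H (v : R) (n : nat) : cos (v + (2 * pi) * n%:R) = cos v.
    by rewrite mulr_natr mulr_natl (periodicn (@cosD2pi R)).
  rewrite /u; case: (k) => n.
    by rewrite -[LHS](H _ n) subrK.
  by rewrite NegzE rmorphN mulrN opprK H.
have u00 : u = 0.
  have cos1 (v : R) : 0 <= v <= pi -> cos v = 1 -> v = 0.
    move=> v01 cv; apply: cos_inj; rewrite ?cos0// in_itv/= ?lexx ?pi_ge0//.
  have [up|pu] := leP u pi; first by apply: cos1; rewrite // u0.
  have : 2 * pi - u = 0.
    apply: cos1; first by apply/andP; split; lra.
    by rewrite addrC mulr_natl cosD2pi cosN.
  lra.
by apply/asboolP; exists k; move: u00; rewrite /u; lra.
Qed.

Lemma cosT_angle t : cosT (angle t) = cos t.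
Proof.
have /angleP/cos_sin_equiv_2pi[] := angle_repr (angle t).
by rewrite /cosT => ->.
Qed.

Lemma sinT_angle t : sinT (angle t) = sin t.
Proof.
have /angleP/cos_sin_equiv_2pi[] := angle_repr (angle t).
by rewrite /sinT => _ ->.
Qed.

Lemma cosT2DsinT2 a : cosT a ^+ 2 + sinT a ^+ 2 = 1.
Proof. exact: cos2Dsin2. Qed.

Lemma circle_inj a b : cosT a = cosT b -> sinT a = sinT b -> a = b.
Proof.
move=> ec es; rewrite -(angle_repr a) -(angle_repr b).
by apply/angleP/cos_sin_equiv_2pi.
Qed.

Lemma borel_circle d (X : measurableType d) (g : X -> circle) :
  (forall U : set circle, open U -> measurable (g @^-1` U)) ->
  measurable_fun setT g.
Proof.
move=> mg; apply: (measurability (@open circle)) => //.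
by move=> _ [U oU <-]; rewrite setTI; exact: mg.
Qed.

Lemma measurable_angle : measurable_fun setT angle.
Proof.
apply: borel_circle => U oU; apply: open_measurable.
by move: U oU; apply/continuousP; exact: pi_continuous.
Qed.

Lemma measurable_circle_lift (h : R -> R) :
  continuous h -> (forall s t, equiv_2pi s t -> h s = h t) ->
  measurable_fun setT (h \o repr : circle -> R).
Proof.
move=> ch hE; apply: (measurability _ (RGenOpens.measurableE R)).
move=> _ [_ [a [b ->] <-]]; rewrite setTI.
apply: sub_sigma_algebra.
have /continuousP : continuous (h \o repr : circle -> R).
  apply: repr_comp_continuous => // s t /eqP/(eqmodP equiv_2pi_rel) /hE ->.
  exact: eqxx.
apply; exact: interval_open.
Qed.

Lemma measurable_cosT : measurable_fun setT cosT.
Proof.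
apply: measurable_circle_lift; first exact: continuous_cos.
by move=> s t /cos_sin_equiv_2pi[].
Qed.

Lemma measurable_sinT : measurable_fun setT sinT.
Proof.
apply: measurable_circle_lift; first exact: continuous_sin.
by move=> s t /cos_sin_equiv_2pi[].
Qed.

End circle.

Section spaces.
Variable R : realType.

Definition unit_sphere : set 'cV[R]_3 := [set x | \sum_i x i 0 ^+ 2 = 1].
Definition special_orthogonal : set 'M[R]_3 :=
  [set Q | Q *m Q^T = 1%:M /\ \det Q = 1].

Definition S2 : Type := set_type unit_sphere.
HB.instance Definition _ := SubType.copy S2 (set_type unit_sphere).
HB.instance Definition _ := Topological.copy S2 (set_type unit_sphere).

Lemma north_subproof : (delta_mx 2%:R 0 : 'cV[R]_3) \in unit_sphere.
Proof.
rewrite inE /unit_sphere/= (bigD1 2%:R)//= mxE !eqxx expr1n big1 ?addr0//.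
by move=> i /negPf i2; rewrite mxE i2 expr0n.
Qed.

HB.instance Definition _ := isPointed.Build S2 (exist (fun x => x \in unit_sphere) _ north_subproof).
HB.instance Definition _ :=
  Measurable.copy S2 (g_sigma_algebraType (@open S2)).

Definition SO3 : Type := set_type special_orthogonal.
HB.instance Definition _ := SubType.copy SO3 (set_type special_orthogonal).
HB.instance Definition _ := Topological.copy SO3 (set_type special_orthogonal).

Lemma SO3_1_subproof : (1%:M : 'M[R]_3) \in special_orthogonal.
Proof. by rewrite inE; split; rewrite ?trmx1 ?mulmx1 ?det1. Qed.

HB.instance Definition _ := isPointed.Build SO3 (exist (fun Q => Q \in special_orthogonal) _ SO3_1_subproof).
HB.instance Definition _ :=
  Measurable.copy SO3 (g_sigma_algebraType (@open SO3)).

Lemma measurable_open_mx m n (A : set 'M[R]_(m, n)) d (X : measurableType d)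
    (g : X -> set_type A) :
  (forall i j, measurable_fun setT (fun x => \val (g x) i j)) ->
  forall U : set (set_type A), open U -> measurable (g @^-1` U).
Proof.
move=> mg _ [U oU <-].
pose B (p : 'M[rat]_(m, n) * nat) : set 'M[R]_(m, n) :=
  [set M | forall i j, ball (ratr (p.1 i j) : R) p.2.+1%:R^-1 (M i j)].
have -> : g @^-1` (set_val @^-1` U) =
    \bigcup_(p in [set p | B p `<=` U]) ((\val \o g) @^-1` B p).
  apply/seteqP; split=> x /=; last by move=> [p pU Bx]; exact: pU.
  move=> Ux; have /nbhs_ballP[e /= e0 eU] : nbhs (\val (g x)) U.
    exact: open_nbhs_nbhs.
  pose N := (Num.truncn (2 / e)).
  have Ne : N.+1%:R^-1 + N.+1%:R^-1 < e.
    have := truncnS_gt (2 / e); rewrite -/N ltr_pdivrMr// => h.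
    by rewrite -mulr2n -[ltLHS]mulr_natl ltr_pdivrMr ?ltr0n// mulrC.
  have N0 : 0 < N.+1%:R^-1 :> R by rewrite invr_gt0.
  have H (y : R) : exists q : rat, ball (ratr q : R) N.+1%:R^-1 y.
    have [q] : exists q, ratr q \in `]y, y + N.+1%:R^-1[.
      by apply: rat_in_itvoo; rewrite ltrDl.
    rewrite in_itv/= => /andP[q1 q2]; exists q.
    by rewrite /ball/= gtr0_norm ?subr_gt0// ltrBlDl.
  pose Q : 'M[rat]_(m, n) := \matrix_(i, j) xchoose (H (\val (g x) i j)).
  have HQ i j : ball (ratr (Q i j) : R) N.+1%:R^-1 (\val (g x) i j).
    by rewrite mxE; exact: (xchooseP (H _)).
  exists (Q, N) => //= M BM; apply: eU; split=> // i j.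
  apply: le_ball (ltW Ne) _ _.
  by apply: ball_triangle (BM i j); exact/ball_sym/HQ.
rewrite bigcup_mkcond; apply: countable_bigcupT_measurable => [|p]; first exact: countableP.
case: ifPn => // _.
have -> : (\val \o g) @^-1` B p =
    \bigcap_(ij in [set: 'I_m * 'I_n]) ((fun x => \val (g x) ij.1 ij.2) @^-1`
      ball (ratr (p.1 ij.1 ij.2) : R) p.2.+1%:R^-1).
  by apply/seteqP; split=> x /= Bx; [move=> [i j] _; exact: Bx|
    move=> i j; exact: (Bx (i, j))].
apply: fin_bigcap_measurable => // -[i j] _ /=.
rewrite -[X in measurable X]setTI; apply: mg => //.
by apply: open_measurable; apply: ball_open; rewrite invr_gt0.
Qed.

Lemma borel_S2 d (X : measurableType d) (g : X -> S2) :
  (forall i, measurable_fun setT (fun x => \val (g x) i 0)) ->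
  measurable_fun setT g.
Proof.
move=> mg; apply: (measurability (@open S2)) => //.
move=> _ [U oU <-]; rewrite setTI.
by apply: (measurable_open_mx _ oU) => i j; rewrite ord1; exact: mg.
Qed.

Lemma borel_SO3 d (X : measurableType d) (g : X -> SO3) :
  (forall i j, measurable_fun setT (fun x => \val (g x) i j)) ->
  measurable_fun setT g.
Proof.
move=> mg; apply: (measurability (@open SO3)) => //.
by move=> _ [U oU <-]; rewrite setTI; exact: (measurable_open_mx mg oU).
Qed.

Lemma measurable_S2_coord i : measurable_fun setT (fun x : S2 => \val x i 0).
Proof.
apply: (measurability _ (RGenOpens.measurableE R)).
move=> _ [_ [a [b ->] <-]]; rewrite setTI.
apply: sub_sigma_algebra.
exists ((fun M : 'cV[R]_3 => M i 0) @^-1` `]a, b[%classic) => //.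
have oI : open (`]a, b[%classic : set R) by exact: interval_open.
by move: oI; move: `]a, b[%classic; apply/continuousP => M; exact: coord_continuous.
Qed.

Lemma measurable_SO3_coord i j :
  measurable_fun setT (fun Q : SO3 => \val Q i j).
Proof.
apply: (measurability _ (RGenOpens.measurableE R)).
move=> _ [_ [a [b ->] <-]]; rewrite setTI.
apply: sub_sigma_algebra.
exists ((fun M : 'M[R]_3 => M i j) @^-1` `]a, b[%classic) => //.
have oI : open (`]a, b[%classic : set R) by exact: interval_open.
by move: oI; move: `]a, b[%classic; apply/continuousP => M; exact: coord_continuous.
Qed.

End spaces.

Section rotations.
Variable R : realType.
Local Notation circle := (circle R).
Local Notation S2 := (S2 R).
Local Notation SO3 := (SO3 R).

Definition mx_of_rows m n (s : seq (seq R)) : 'M[R]_(m, n) :=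
  \matrix_(i, j) (nth [::] s i)`_j.

Definition R3 (a : circle) : 'M[R]_3 := mx_of_rows 3 3
  [:: [:: cosT a; - sinT a; 0];
      [:: sinT a;   cosT a; 0];
      [::      0;        0; 1]].

Definition R2 (b : R) : 'M[R]_3 := mx_of_rows 3 3
  [:: [::   cos b; 0; sin b];
      [::       0; 1;     0];
      [:: - sin b; 0; cos b]].

Lemma SO3_mul_subproof (P Q : 'M[R]_3) : special_orthogonal P ->
  special_orthogonal Q -> special_orthogonal (P *m Q).
Proof.
move=> [P1 P2] [Q1 Q2]; split; last by rewrite det_mulmx P2 Q2 mulr1.
by rewrite trmx_mul mulmxA -(mulmxA P) Q1 mulmx1.
Qed.

Lemma det_mx33 (A : 'M[R]_3) : \det A =
  A 0 0 * (A 1 1 * A 2%:R 2%:R - A 1 2%:R * A 2%:R 1)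
  - A 0 1 * (A 1 0 * A 2%:R 2%:R - A 1 2%:R * A 2%:R 0)
  + A 0 2%:R * (A 1 0 * A 2%:R 1 - A 1 1 * A 2%:R 0).
Proof.
pose f := fun x y : nat => A (inord x) (inord y).
have E i j : A i j = f i j by rewrite /f !inord_val.
rewrite (expand_det_row _ 0) !big_ord_recl big_ord0 addr0 /cofactor.
rewrite !(expand_det_row _ 0) !big_ord_recl !big_ord0 !addr0 /cofactor.
rewrite !det_mx11 !mxE !E /=; clearbody f.
rewrite /bump /= !addn0 ?addn1 ?addnE /= expr0 expr1 sqrrN expr1n !mul1r.
ring.
Qed.

Lemma R3_SO3 a : special_orthogonal (R3 a).
Proof.
have := cosT2DsinT2 a.
split; last by rewrite det_mx33 !mxE/=; lra.
apply/matrixP => i j; rewrite !mxE !big_ord_recl big_ord0 !mxE.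
by case: i => [[|[|[|//]]] ?]; case: j => [[|[|[|//]]] ?]; rewrite /=; lra.
Qed.

Lemma R2_SO3 b : special_orthogonal (R2 b).
Proof.
have := cos2Dsin2 b.
split; last by rewrite det_mx33 !mxE/=; lra.
apply/matrixP => i j; rewrite !mxE !big_ord_recl big_ord0 !mxE.
by case: i => [[|[|[|//]]] ?]; case: j => [[|[|[|//]]] ?]; rewrite /=; lra.
Qed.

Lemma Psi_subproof (a : circle) (b : R) (c : circle) :
  (R3 a *m R2 b *m R3 c) \in @special_orthogonal R.
Proof.
rewrite inE; do 2?[apply: SO3_mul_subproof]; [|exact: R2_SO3|];
  exact: R3_SO3.
Qed.

Definition Psi (a : circle) (b : R) (c : circle) : SO3 :=
  exist (fun Q => Q \in @special_orthogonal R) _ (Psi_subproof a b c).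

Lemma transpose_subproof (Q : SO3) : (\val Q)^T \in @special_orthogonal R.
Proof.
have := valP Q; rewrite !inE => -[Q1 Q2]; split; last by rewrite det_tr.
by rewrite trmxK; exact: mulmx1C.
Qed.

Definition transpose (Q : SO3) : SO3 :=
  exist (fun Q => Q \in @special_orthogonal R) _ (transpose_subproof Q).

Lemma sphereP (x : 'cV[R]_3) : unit_sphere x <-> x^T *m x = 1%:M.
Proof.
rewrite /unit_sphere/=; split=> [x1|/matrixP/(_ 0 0)].
  apply/matrixP => i j; rewrite !ord1 !mxE -x1.
  by apply: eq_bigr => k _; rewrite mxE expr2.
rewrite !mxE eqxx => e; apply: etrans e; apply: eq_bigr => k _.
by rewrite mxE expr2.
Qed.

Lemma rotate_subproof (Q : SO3) (x : S2) :
  (\val Q *m \val x) \in @unit_sphere R.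
Proof.
have := valP Q; rewrite !inE => -[/mulmx1C Q1 _].
have := valP x; rewrite inE => /sphereP x1.
by apply/sphereP; rewrite trmx_mul mulmxA -(mulmxA _ _ (\val Q)) Q1 mulmx1.
Qed.

Definition rotate (Q : SO3) (x : S2) : S2 :=
  exist (fun x => x \in @unit_sphere R) _ (rotate_subproof Q x).

Definition Phi_col (phi : circle) (theta : R) : 'cV[R]_3 := mx_of_rows 3 1
  [:: [:: cosT phi * sin theta];
      [:: sinT phi * sin theta];
      [:: cos theta]].

Lemma Phi_subproof phi theta : Phi_col phi theta \in @unit_sphere R.
Proof.
rewrite inE /unit_sphere/= !big_ord_recl big_ord0 !mxE/= addr0 -(cos2Dsin2 theta).
by rewrite addrA !exprMn -mulrDl cosT2DsinT2 mul1r addrC.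
Qed.

Definition Phi (phi : circle) (theta : R) : S2 :=
  exist (fun x => x \in @unit_sphere R) _ (Phi_subproof phi theta).

(* Off the poles there is exactly one such phi (azi_Phi); at the poles there is
   none and xget returns its default, the class of 0. *)
Definition azi (x : S2) : circle := xget (angle 0)
  [set phi | exists2 theta, 0 < theta < pi & Phi phi theta = x].

Definition pol (x : S2) : R := acos (\val x 2%:R 0).

Definition azimuth (a : circle) (b : R) (x : S2) : circle :=
  azi (rotate (transpose (Psi a b (angle 0))) x).

(* eta = Phi alpha beta determines beta = pol eta, and alpha = azi eta off the
   poles; at the poles alpha is 0 by the convention on azi. *)
Definition T_W (p : S2 * S2) : SO3 :=
  let: (eta, x) := p in Psi (azi eta) (pol eta) (azimuth (azi eta) (pol eta) x).

End rotations.

Section measurability.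
Variable R : realType.
Local Notation circle := (circle R).
Local Notation S2 := (S2 R).
Local Notation SO3 := (SO3 R).

Lemma Phi_inj (phi phi' : circle) (theta theta' : R) :
  0 < theta < pi -> 0 < theta' < pi -> Phi phi theta = Phi phi' theta' ->
  phi = phi' /\ theta = theta'.
Proof.
move=> t t' /(congr1 val)/matrixP e.
have := e 2%:R 0; rewrite !mxE/= => ec.
have et : theta = theta'.
  apply: cos_inj => //; rewrite in_itv/=.
    by case/andP: t => /ltW -> /ltW ->.
  by case/andP: t' => /ltW -> /ltW ->.
subst theta'; split=> //.
have s0 : sin theta != 0 by rewrite gt_eqF// sin_gt0_pi.
apply: circle_inj; apply: (mulIf s0).
  by have := e 0 0; rewrite !mxE.
by have := e 1 0; rewrite !mxE.
Qed.

Lemma azi_Phi (phi : circle) (theta : R) :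
  0 < theta < pi -> azi (Phi phi theta) = phi.
Proof.
move=> t; rewrite /azi; case: xgetP => [psi _ [theta' t' e]|/(_ phi)[]].
  by have [] := Phi_inj t' t e.
by exists theta.
Qed.

Lemma S2_coord (x : S2) :
  \val x 0 0 ^+ 2 + \val x 1 0 ^+ 2 + \val x 2%:R 0 ^+ 2 = 1.
Proof.
have := valP x; rewrite inE /unit_sphere/= !big_ord_recl big_ord0 addr0 addrA.
move=> e; rewrite -{}[RHS]e; congr (_ ^+ 2 + _ ^+ 2 + _ ^+ 2);
  by congr (\val x _ _); apply/val_inj.
Qed.

Lemma S2_z_itv (x : S2) : -1 <= \val x 2%:R 0 <= 1.
Proof.
rewrite -ler_norml -(@ler_pXn2r _ 2)// ?nnegrE// expr1n real_normK ?num_real//.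
by rewrite -(S2_coord x) lerDr addr_ge0// sqr_ge0.
Qed.

Lemma cos_pol (x : S2) : cos (pol x) = \val x 2%:R 0.
Proof. by rewrite /pol acosK// in_itv/= S2_z_itv. Qed.

Lemma pol_itv (x : S2) : 0 <= pol x <= pi.
Proof. by rewrite acos_ge0 ?acos_lepi ?S2_z_itv. Qed.

Lemma pol_itvoo (x : S2) : sin (pol x) != 0 -> 0 < pol x < pi.
Proof.
have /andP[p0 p1] := pol_itv x.
rewrite !lt_neqAle p0 p1 !andbT => s0; apply/andP; split.
  by apply: contraNneq s0 => <-; rewrite sin0.
by apply: contraNneq s0 => ->; rewrite sinpi.
Qed.

Lemma sin_pol_sqr (x : S2) :
  sin (pol x) ^+ 2 = \val x 0 0 ^+ 2 + \val x 1 0 ^+ 2.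
Proof. by rewrite sin2cos2 cos_pol -(S2_coord x) addrK. Qed.

Definition azi_real (x : S2) : R :=
  let c := acos (\val x 0 0 / sin (pol x)) in if 0 <= \val x 1 0 then c else - c.

Lemma Phi_azi_real (x : S2) : sin (pol x) != 0 ->
  Phi (angle (azi_real x)) (pol x) = x.
Proof.
move=> s0; have sp : 0 < sin (pol x) by apply: sin_gt0_pi; exact: pol_itvoo.
have sq := sin_pol_sqr x.
set s := sin (pol x) in s0 sp sq *; set X := \val x 0 0 in sq *.
set Y := \val x 1 0 in sq *.
have Xs : -1 <= X / s <= 1.
  rewrite ler_pdivlMr// ler_pdivrMr// mul1r mulN1r -ler_norml.
  rewrite -(@ler_pXn2r _ 2)// ?nnegrE// ?(ltW sp)//.
  by rewrite real_normK ?num_real// sq lerDl sqr_ge0.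
have cE : cos (azi_real x) = X / s.
  by rewrite /azi_real; case: ifP => _; rewrite ?cosN acosK.
have sE : sin (azi_real x) = Y / s.
  have e : Num.sqrt (1 - (X / s) ^+ 2) = `|Y| / s.
    have -> : 1 - (X / s) ^+ 2 = (Y / s) ^+ 2.
      rewrite !expr_div_n sq; field.
      by rewrite -sq expf_neq0.
    by rewrite sqrtr_sqr normrM normfV (gtr0_norm sp).
  rewrite /azi_real -/X -/Y -/s; case: (lerP 0 Y) => Y0.
    by rewrite sin_acos// e ger0_norm.
  by rewrite sinN sin_acos// e ltr0_norm// mulNr opprK.
apply/val_inj/matrixP => i j; rewrite ord1 !mxE cosT_angle sinT_angle cE sE.
rewrite -/s !divfK// cos_pol.
by case: i => [[|[|[|//]]] ?] /=; congr (\val x _ _); apply/val_inj.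
Qed.

Lemma aziE (x : S2) :
  azi x = if sin (pol x) == 0 then angle 0 else angle (azi_real x).
Proof.
case: ifPn => [/eqP s0|s0].
  rewrite /azi; case: xgetP => // phi _ [theta t e].
  have : pol x = theta.
    by rewrite -e /pol mxE/= cosK// in_itv/=; case/andP: t => /ltW -> /ltW ->.
  by move=> pt; have := sin_gt0_pi t; rewrite -pt s0 ltxx.
by rewrite -{1}(Phi_azi_real s0) azi_Phi// pol_itvoo.
Qed.

Lemma azi_pole (x : S2) : `|\val x 2%:R 0| = 1 -> azi x = angle 0.
Proof.
by rewrite aziE -cos_pol => /cos1sin0 ->; rewrite eqxx.
Qed.

Lemma measurable_acos_itv d (X : measurableType d) (g : X -> R) :
  (forall x, -1 <= g x <= 1) -> measurable_fun setT g ->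
  measurable_fun setT (acos \o g).
Proof.
move=> g1 mg.
pose clamp (t : R) := Num.max (-1) (Num.min 1 t).
have cl1 t : -1 <= clamp t <= 1.
  rewrite /clamp le_max lexx/= ge_max ge_min lexx/= andbT; lra.
have clamp_homo : {homo clamp : s t / s <= t}.
  by move=> s t st; rewrite /clamp le_max2// le_min2.
have -> : acos \o g = (acos \o clamp) \o g.
  apply/funext => x /=; congr acos; have /andP[h1 h2] := g1 x.
  by rewrite /clamp min_r// max_r.
apply: measurableT_comp mg; apply: nonincreasing_measurable => // s t st /=.
rewrite leNgt -ltr_cos ?in_itv/= ?acos_ge0 ?acos_lepi//.
by rewrite !acosK ?in_itv//= -leNgt clamp_homo.
Qed.

Lemma measurable_pol : measurable_fun setT (@pol R).
Proof.
by apply: measurable_acos_itv; [exact: S2_z_itv|exact: measurable_S2_coord].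
Qed.

Lemma measurable_sin : measurable_fun setT (@sin R).
Proof. by apply: continuous_measurable_fun; exact: continuous_sin. Qed.

Lemma measurable_cos : measurable_fun setT (@cos R).
Proof. by apply: continuous_measurable_fun; exact: continuous_cos. Qed.

Lemma measurable_azi : measurable_fun setT (@azi R).
Proof.
have msp : measurable_fun setT (fun x : S2 => sin (pol x)).
  exact: measurableT_comp measurable_sin measurable_pol.
(* x / sin (pol x) = x * exp (- ln (sin (pol x))) off the poles *)
pose q (x : S2) : R := if sin (pol x) == 0 then 0 else
  \val x 0 0 * expR (- ln (sin (pol x))).
have qE x : sin (pol x) != 0 -> q x = \val x 0 0 / sin (pol x).
  move=> s0; rewrite /q (negPf s0); congr (_ * _).
  by rewrite expRN lnK// posrE sin_gt0_pi// pol_itvoo.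
have q1 x : -1 <= q x <= 1.
  have [s0|s0] := eqVneq (sin (pol x)) 0.
    by rewrite /q s0 eqxx lerN10 ler01.
  have sp : 0 < sin (pol x) by apply: sin_gt0_pi; exact: pol_itvoo.
  rewrite qE// ler_pdivlMr// ler_pdivrMr// mul1r mulN1r -ler_norml.
  rewrite -(@ler_pXn2r _ 2)// ?nnegrE// ?(ltW sp)//.
  by rewrite real_normK ?num_real// sin_pol_sqr lerDl sqr_ge0.
have mq : measurable_fun setT q.
  apply: measurable_fun_ifT => //.
    exact: measurable_fun_eqr.
  apply: measurable_funM; first exact: measurable_S2_coord.
  apply: measurableT_comp => //; apply: measurableT_comp => //.
  exact: measurableT_comp (@measurable_ln R) msp.
have maq := measurable_acos_itv q1 mq.
have -> : @azi R = fun x => if sin (pol x) == 0 then angle 0 else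
    angle (if 0 <= \val x 1 0 then acos (q x) else - acos (q x)).
  apply/funext => x; rewrite aziE; case: ifPn => // s0.
  by rewrite /azi_real qE.
apply: measurable_fun_ifT => //; first exact: measurable_fun_eqr.
apply: measurableT_comp (@measurable_angle R) _.
apply: measurable_fun_ifT => //; last exact: measurableT_comp.
by apply: measurable_fun_ler => //; exact: measurable_S2_coord.
Qed.

Lemma measurable_fun_Phi d (X : measurableType d)
    (a : X -> circle) (b : X -> R) :
  measurable_fun setT a -> measurable_fun setT b ->
  measurable_fun setT (fun x => Phi (a x) (b x)).
Proof.
move=> ma mb.
have m1 := measurableT_comp (@measurable_cosT R) ma.
have m2 := measurableT_comp (@measurable_sinT R) ma.
have m3 := measurableT_comp measurable_sin mb.
have m4 := measurableT_comp measurable_cos mb.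
apply: borel_S2 => i /=; under eq_fun do rewrite mxE.
by case: i => [[|[|[|//]]] ?] /=;
  [exact: measurable_funM m1 m3|exact: measurable_funM m2 m3|exact: m4].
Qed.

Lemma measurable_Phi :
  measurable_fun setT (fun p : circle * R => Phi p.1 p.2).
Proof.
by apply: measurable_fun_Phi; [exact: measurable_fst|exact: measurable_snd].
Qed.

Lemma measurable_mulmx d (X : measurableType d) m n p
    (A : X -> 'M[R]_(m, n)) (B : X -> 'M[R]_(n, p)) :
  (forall i j, measurable_fun setT (fun x => A x i j)) ->
  (forall i j, measurable_fun setT (fun x => B x i j)) ->
  forall i j, measurable_fun setT (fun x => (A x *m B x) i j).
Proof.
move=> mA mB i j; under eq_fun do rewrite mxE.
by apply: measurable_sum => k; exact: measurable_funM.
Qed.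

Lemma measurable_R3 d (X : measurableType d) (a : X -> circle) :
  measurable_fun setT a ->
  forall i j, measurable_fun setT (fun x => R3 (a x) i j).
Proof.
move=> ma i j; under eq_fun do rewrite mxE.
have m1 := measurableT_comp (@measurable_cosT R) ma.
have m2 := measurableT_comp (@measurable_sinT R) ma.
have m3 : measurable_fun setT (fun x => - sinT (a x)) by exact: measurableT_comp m2.
by case: i => [[|[|[|//]]] ?]; case: j => [[|[|[|//]]] ?] /=;
  solve [exact: m1|exact: m2|exact: m3|exact: measurable_cst].
Qed.

Lemma measurable_R2 d (X : measurableType d) (b : X -> R) :
  measurable_fun setT b ->
  forall i j, measurable_fun setT (fun x => R2 (b x) i j).
Proof.
move=> mb i j; under eq_fun do rewrite mxE.
have m1 := measurableT_comp measurable_cos mb.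
have m2 := measurableT_comp measurable_sin mb.
have m3 : measurable_fun setT (fun x => - sin (b x)) by exact: measurableT_comp m2.
by case: i => [[|[|[|//]]] ?]; case: j => [[|[|[|//]]] ?] /=;
  solve [exact: m1|exact: m2|exact: m3|exact: measurable_cst].
Qed.

Lemma measurable_Psi_mx d (X : measurableType d)
    (a : X -> circle) (b : X -> R) (c : X -> circle) :
  measurable_fun setT a -> measurable_fun setT b -> measurable_fun setT c ->
  forall i j, measurable_fun setT
    (fun x => (R3 (a x) *m R2 (b x) *m R3 (c x)) i j).
Proof.
move=> ma mb mc; apply: measurable_mulmx; last exact: measurable_R3.
by apply: measurable_mulmx; [exact: measurable_R3|exact: measurable_R2].
Qed.

Lemma measurable_fun_Psi d (X : measurableType d)
    (a : X -> circle) (b : X -> R) (c : X -> circle) :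
  measurable_fun setT a -> measurable_fun setT b -> measurable_fun setT c ->
  measurable_fun setT (fun x => Psi (a x) (b x) (c x)).
Proof. by move=> ma mb mc; apply: borel_SO3 => /=; exact: measurable_Psi_mx. Qed.

Lemma measurable_fun_azimuth d (X : measurableType d)
    (a : X -> circle) (b : X -> R) (x : X -> S2) :
  measurable_fun setT a -> measurable_fun setT b -> measurable_fun setT x ->
  measurable_fun setT (fun t => azimuth (a t) (b t) (x t)).
Proof.
move=> ma mb mx; apply: (measurableT_comp measurable_azi).
apply: borel_S2 => i /=; apply: measurable_mulmx => {i} [i j|i j].
  under eq_fun do rewrite mxE.
  by apply: measurable_Psi_mx => //; exact: measurable_cst.
by rewrite ord1; exact: (measurableT_comp (measurable_S2_coord i) mx).
Qed.

Lemma measurable_azimuth (a : circle) (b : R) :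
  measurable_fun setT (azimuth a b).
Proof.
apply: measurable_fun_azimuth; [exact: measurable_cst|exact: measurable_cst|].
exact: measurable_id.
Qed.

Lemma measurable_Psi :
  measurable_fun setT (fun p : circle * R * circle => Psi p.1.1 p.1.2 p.2).
Proof.
apply: measurable_fun_Psi; last exact: measurable_snd.
  exact: measurableT_comp measurable_fst measurable_fst.
exact: measurableT_comp measurable_snd measurable_fst.
Qed.

Lemma measurable_T_W : measurable_fun setT (@T_W R).
Proof.
have -> : @T_W R = fun p => Psi (azi p.1) (pol p.1)
  (azimuth (azi p.1) (pol p.1) p.2) by apply/funext => -[].
have m1 := measurableT_comp measurable_azi (@measurable_fst _ _ S2 S2).
have m2 := measurableT_comp measurable_pol (@measurable_fst _ _ S2 S2).
apply: measurable_fun_Psi; [exact: m1|exact: m2|].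
by apply: measurable_fun_azimuth; [exact: m1|exact: m2|exact: measurable_snd].
Qed.

End measurability.

Section pushforwards.
Local Open Scope ereal_scope.
Context d1 d2 (T1 : measurableType d1) (T2 : measurableType d2) (R : realType).
Variable f : {mfun T1 >-> T2}.

Let mpre A : measurable A -> measurable (f @^-1` A).
Proof. by move=> mA; rewrite -[X in measurable X]setTI; exact: measurable_funP. Qed.

Let bigcup_pre (F : (set T2)^nat) : f @^-1` (\bigcup_n F n) = \bigcup_n (f @^-1` F n).
Proof. exact: preimage_bigcup. Qed.

Let triv (F : (set T2)^nat) :
  trivIset setT F -> trivIset setT (fun n => f @^-1` F n).
Proof.
move=> /trivIsetP tF; apply/trivIsetP => i j _ _ ij.
by rewrite -preimage_setI tF// preimage_set0.
Qed.

(* pushforward along a bundled measurable map, for structure inference *)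
Definition mpushforward (m : {measure set T1 -> \bar R}) : set T2 -> \bar R :=
  pushforward m f.

Section measure.
Variable m : {measure set T1 -> \bar R}.

Let m0 : mpushforward m set0 = 0.
Proof. by rewrite /mpushforward /pushforward preimage_set0 measure0. Qed.

Let m_ge0 A : 0 <= mpushforward m A.
Proof. exact: measure_ge0. Qed.

Let m_sigma : semi_sigma_additive (mpushforward m).
Proof.
move=> F mF tF mUF; rewrite /mpushforward /pushforward bigcup_pre.
apply: measure_semi_sigma_additive; [by move=> n; exact: mpre|exact: triv|].
by rewrite -bigcup_pre; exact: mpre.
Qed.

HB.instance Definition _ := isMeasure.Build _ _ _ (mpushforward m) m0 m_ge0 m_sigma.
End measure.

Section finite.
Variable m : {finite_measure set T1 -> \bar R}.
Let m_fin : fin_num_fun (mpushforward m).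
Proof. by move=> A mA; apply: fin_num_measure; exact: mpre. Qed.
HB.instance Definition _ := @Measure_isFinite.Build _ _ _ (mpushforward m) m_fin.
End finite.

Section charge.
Variable nu : {charge set T1 -> \bar R}.
Definition cpushforward : set T2 -> \bar R := pushforward nu f.

Let nu0 : cpushforward set0 = 0.
Proof. by rewrite /cpushforward /pushforward preimage_set0 charge0. Qed.

Let nu_fin A : measurable A -> cpushforward A \is a fin_num.
Proof. by move=> mA; rewrite /cpushforward /pushforward fin_num_measure//; exact: mpre. Qed.

Let nu_sigma : semi_sigma_additive cpushforward.
Proof.
move=> F mF tF mUF; rewrite /cpushforward /pushforward bigcup_pre.
apply: charge_semi_sigma_additive; [by move=> n; exact: mpre|exact: triv|].
by rewrite -bigcup_pre; exact: mpre.
Qed.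

HB.instance Definition _ := isCharge.Build _ _ _ cpushforward nu0 nu_fin nu_sigma.
End charge.
End pushforwards.

Lemma product_fin_num_fun d1 d2 (T1 : measurableType d1)
    (T2 : measurableType d2) (R : realType)
    (m1 : {finite_measure set T1 -> \bar R})
    (m2 : {finite_measure set T2 -> \bar R}) : fin_num_fun (m1 \x m2)%E.
Proof.
apply: lty_fin_num_fun.
apply: (@le_lt_trans _ _ (m1 setT * m2 setT)%E).
  by rewrite -product_measure1E// setXTT.
by rewrite lte_mul_pinfty ?measure_ge0 ?fin_num_measure// ltey_eq fin_num_measure.
Qed.

Section product_charge.
Local Open Scope ereal_scope.
Context d1 d2 (T1 : measurableType d1) (T2 : measurableType d2) (R : realType).
Variables (m : {finite_measure set T1 -> \bar R}).
Variable (nu : {charge set T2 -> \bar R}).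

(* A |-> \int[m]_x nu (xsection A x) *)
Definition cproduct : set (T1 * T2) -> \bar R := m \x nu.

Let prod_fin (k : {finite_measure set T2 -> \bar R}) : fin_num_fun (m \x k).
Proof. exact: product_fin_num_fun. Qed.

Let cproductE (P N : set T2) (h : hahn_decomposition nu P N) A : measurable A ->
  cproduct A = (m \x jordan_pos h) A - (m \x jordan_neg h) A.
Proof.
move=> mA; rewrite /cproduct /product_measure1 -integralB//; first last.
- apply/integrableP; split; first exact: measurable_fun_xsection.
  under eq_integral do rewrite /= gee0_abs//.
  by have := prod_fin (jordan_neg h) mA; rewrite ge0_fin_numE ?measure_ge0.
- apply/integrableP; split; first exact: measurable_fun_xsection.
  under eq_integral do rewrite /= gee0_abs//.
  by have := prod_fin (jordan_pos h) mA; rewrite ge0_fin_numE ?measure_ge0.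
apply: eq_integral => x _ /=.
by rewrite (jordan_decomp h (measurable_xsection x mA)) /cadd/= cscaleN1.
Qed.

Let c0 : cproduct set0 = 0.
Proof.
have [P [N h]] := Hahn_decomposition nu.
by rewrite (cproductE h)// !measure0 sube0.
Qed.

Let c_fin A : measurable A -> cproduct A \is a fin_num.
Proof.
have [P [N h]] := Hahn_decomposition nu => mA.
by rewrite (cproductE h)// fin_numB !prod_fin.
Qed.

Let c_sigma : semi_sigma_additive cproduct.
Proof.
have [P [N h]] := Hahn_decomposition nu.
move=> F mF tF mUF; rewrite (cproductE h)//.
under eq_fun do under eq_bigr do rewrite (cproductE h)//.
rewrite (_ : (fun n => _) = (fun n => \sum_(0 <= i < n) (m \x jordan_pos h) (F i)
   - \sum_(0 <= i < n) (m \x jordan_neg h) (F i))); last first.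
  apply/funext => n; rewrite big_split/= sumeN// => i j _ _.
  by rewrite fin_num_adde_defl// prod_fin.
apply: cvgeB; first by rewrite fin_num_adde_defr// prod_fin.
- exact: measure_semi_sigma_additive.
- exact: measure_semi_sigma_additive.
Qed.

HB.instance Definition _ := isCharge.Build _ _ _ cproduct c0 c_fin c_sigma.

End product_charge.

Section measures.
Variable R : realType.
Local Notation circle := (circle R).
Local Notation S2 := (S2 R).
Local Notation SO3 := (SO3 R).

Definition angleR (t : measurableTypeR R) : circle := angle t.
HB.instance Definition _ :=
  isMeasurableFun.Build _ _ _ _ angleR (@measurable_angle R).
HB.instance Definition _ a b :=
  isMeasurableFun.Build _ _ _ _ (azimuth a b) (@measurable_azimuth R a b).
HB.instance Definition _ :=
  isMeasurableFun.Build _ _ _ _ (@T_W R) (@measurable_T_W R).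

Definition Phi2 (p : circle * measurableTypeR R) : S2 := Phi p.1 p.2.
HB.instance Definition _ :=
  isMeasurableFun.Build _ _ _ _ Phi2 (@measurable_Phi R).

Definition Psi3 (p : circle * measurableTypeR R * circle) : SO3 := Psi p.1.1 p.1.2 p.2.
HB.instance Definition _ :=
  isMeasurableFun.Build _ _ _ _ Psi3 (@measurable_Psi R).

Definition sigma_T : set circle -> \bar R :=
  mpushforward angleR
    (mrestr lebesgue_measure (measurable_itv `[0%R, 2 * pi[)).

HB.instance Definition _ := Measure.on sigma_T.

Let sigma_T_fin : fin_num_fun sigma_T.
Proof.
apply: lty_fin_num_fun.
rewrite [X in (X < _)%E](_ : _ = lebesgue_measure (setT `&` `[0%R, 2 * pi[))//.
by rewrite setTI lebesgue_measure_itv/=; case: ifP => _; rewrite ltry.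
Qed.

HB.instance Definition _ := @Measure_isFinite.Build _ _ _ sigma_T sigma_T_fin.

(* sin(t) dt on [0, pi] *)
Definition sin_measure (A : set (measurableTypeR R)) : \bar R :=
  (\int[lebesgue_measure]_(t in A `&` `[0%R, pi]) (sin t)%:E)%E.

Section sin_measure.
Local Open Scope ereal_scope.

Let s0 : sin_measure set0 = 0.
Proof. by rewrite /sin_measure set0I integral_set0. Qed.

Let s_ge0 A : 0 <= sin_measure A.
Proof.
apply: integral_ge0 => t [_ /=]; rewrite in_itv/= => t0pi.
by rewrite lee_fin sin_ge0_pi.
Qed.

Let s_sigma : semi_sigma_additive sin_measure.
Proof.
have -> : sin_measure = fun A =>
    \int[lebesgue_measure]_(t in A) ((fun t => (sin t)%:E) \_ `[0%R, pi]) t.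
  by apply/funext => A; rewrite /sin_measure integral_mkcondr.
apply: semi_sigma_additive_nng_induced.
  apply/(measurable_restrictT _ _).1 => //.
  apply/measurable_EFinP/measurable_funTS; exact: measurable_sin.
move=> t; rewrite patchE; case: ifPn => //; rewrite inE/= in_itv/= => ?.
by rewrite lee_fin sin_ge0_pi.
Qed.

HB.instance Definition _ := isMeasure.Build _ _ _ sin_measure s0 s_ge0 s_sigma.

Let s_fin : fin_num_fun sin_measure.
Proof.
apply: lty_fin_num_fun.
rewrite [X in X < _](_ : _ =
    \int[lebesgue_measure]_(t in `[0%R, pi]) (sin t)%:E); last first.
  by congr integral; exact: setTI.
apply: (@le_lt_trans _ _ (\int[lebesgue_measure]_(t in `[0%R, pi]) (cst 1 t))).
  apply: ge0_le_integral => //.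
  - by move=> t /=; rewrite in_itv/= => ?; rewrite lee_fin sin_ge0_pi.
  - apply/measurable_EFinP/measurable_funTS; exact: measurable_sin.
  - by move=> t _; rewrite lee_fin sin_le1.
rewrite integral_cst//= mul1e lebesgue_measure_itv/=.
by case: ifP => _; rewrite ltry.
Qed.

HB.instance Definition _ := @Measure_isFinite.Build _ _ _ sin_measure s_fin.
End sin_measure.

(* surface measure in spherical coordinates: sin(theta) dphi dtheta *)
Definition sigma_S2 : set S2 -> \bar R :=
  mpushforward Phi2 (sigma_T \x sin_measure)%E.
HB.instance Definition _ := Measure.on sigma_S2.

Let sigma_S2_fin : fin_num_fun sigma_S2.
Proof.
apply: lty_fin_num_fun; rewrite ltey_eq; apply/orP; left.
exact: (product_fin_num_fun sigma_T sin_measure measurableT).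
Qed.

HB.instance Definition _ := @Measure_isFinite.Build _ _ _ sigma_S2 sigma_S2_fin.

Lemma inv4pi_ge0 : 0 <= (4 * pi : R)^-1.
Proof. by rewrite invr_ge0 mulr_ge0// pi_ge0. Qed.

Definition u_S2 : set S2 -> \bar R := mscale (NngNum inv4pi_ge0) sigma_S2.
HB.instance Definition _ := FiniteMeasure.on u_S2.

Definition sigma_SO3 : set SO3 -> \bar R :=
  mpushforward Psi3 (sigma_T \x sin_measure \x sigma_T)%E.
HB.instance Definition _ := Measure.on sigma_SO3.

End measures.

Section transforms.
Variable R : realType.
Local Notation circle := (circle R).
Local Notation S2 := (S2 R).
Local Notation SO3 := (SO3 R).

(* The integral is the Lebesgue integral of a total function. For integrable f
   the integrand is integrable for almost every Q; on the exceptional null set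
   the value is an irrelevant default. *)
Definition semicircle (f : S2 -> R) (Q : SO3) : R :=
  (4 * pi)^-1 * \int[lebesgue_measure]_(t in `[0, pi])
    (f (rotate Q (Phi (angle 0) t)) * sin t).

Definition semicircle_at (a : circle) (b : R) (f : S2 -> R) (c : circle) : R :=
  4 * pi * semicircle f (Psi a b c).

Lemma semicircle_atE a b f c : semicircle_at a b f c =
  \int[lebesgue_measure]_(t in `[0, pi])
    (f (rotate (Psi a b (angle 0)) (Phi c t)) * sin t).
Proof.
rewrite /semicircle_at /semicircle mulrA divff ?mul1r; last first.
  by rewrite mulf_neq0// gt_eqF// pi_gt0.
congr fine; apply: eq_integral => t _; congr (f _ * _)%:E.
apply/val_inj => /=; rewrite -!(mulmxA (R3 a *m R2 b)); congr (_ *m _).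
apply/matrixP => i j; rewrite ord1 !mxE !big_ord_recl !big_ord0 !mxE.
rewrite !cosT_angle !sinT_angle cos0 sin0.
by case: i => [[|[|[|//]]] ?] /=; ring.
Qed.

Definition semicircle_meas (mu : {charge set S2 -> \bar R}) :
    set SO3 -> \bar R :=
  cpushforward (@T_W R) (cproduct (@u_S2 R) mu).
HB.instance Definition _ mu := Charge.on (semicircle_meas mu).

Definition semicircle_meas_at (a : circle) (b : R)
    (mu : {charge set S2 -> \bar R}) : set circle -> \bar R :=
  cpushforward (azimuth a b) mu.
HB.instance Definition _ a b mu := Charge.on (semicircle_meas_at a b mu).

End transforms.

(* nu = h mu as finite signed measures; in particular h is mu-integrable *)
Definition has_density d (T : measurableType d) (R : realType)
    (nu : {charge set T -> \bar R}) (h : T -> R)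
    (mu : {measure set T -> \bar R}) : Prop :=
  exists inth : mu.-integrable [set: T] (EFin \o h),
    forall A, measurable A -> nu A = induced_charge inth A.

Arguments sigma_T R : clear implicits.
Arguments sigma_S2 R : clear implicits.
Arguments sigma_SO3 R : clear implicits.

(* Main.v *)
Require Import Defs.
From HB Require Import structures.
From mathcomp Require Import all_boot all_order all_algebra.
From mathcomp Require Import ring lra.
From mathcomp Require Import all_classical all_reals all_analysis.
From mathcomp Require Import measurable_realfun.
Import Order.TTheory GRing.Theory Num.Theory.
Import numFieldNormedType.Exports.
Local Open Scope classical_set_scope.
Local Open Scope ring_scope.

Set Implicit Arguments.
Unset Strict Implicit.
Unset Printing Implicit Defensive.

(** Both transforms push measures forward along maps whose fibres are half
    great circles, so the densities are integrals along these fibres, by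
    Fubini's theorem in spherical coordinates about the right axis.

    Fix [a] and [b] and let [Q = Psi a b 0].  For [0 < t < pi] the point
    [Q Phi(c, t)] has azimuth [c] relative to [(a, b)].  If the surface measure
    is [sin t dc dt] in the coordinates [(c, t) |-> Q Phi(c, t)], then the mass
    that [f sigma] gives to the points with azimuth in [A] is
    [\int_A \int_0^pi f (Q Phi(c, t)) sin t dt dc] ([integral_azimuth]), and
    the inner integral is the semicircle transform of [f] at [c].

    The surface measure is defined in the coordinates [Phi] about the [z]-axis,
    so this needs its invariance under [Q] ([invariant_rotate]).  Rotations
    about the [z]-axis only shift the longitude.  For the others, use [x] and
    [z] as coordinates on the hemispheres [y > 0] and [y < 0]: the surface
    measure becomes [dx dz / |y|] with [|y| = sqrt (1 - x^2 - z^2)]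
    ([integral_sphere_slices]), which is symmetric in [x] and [z], so by
    Tonelli's theorem the exchange of [x] and [z] preserves it
    ([invariant_swap]).  This exchange and the rotations about the [z]-axis
    generate the rotations about the [y]-axis ([rotateY_swap]).

    For the transform with values on SO(3), the first part applies to the set
    of [c] with [Psi a b c] in [A], for almost every [(a, b)]; integrating over
    [(a, b)] yields the triple integral by which the measure of SO(3) is
    defined ([semicircle_measE]).  Its integrability follows from the first part
    for [|f|] ([integrable_half_circle_integral]).  Absolute continuity is a
    consequence of having a density ([has_density_dominates]). *)

(** * Integrals against densities and image measures *)

Section density.
Local Open Scope ereal_scope.
Context d (T : measurableType d) (R : realType).
Variable mu : {measure set T -> \bar R}.

Import HBNNSimple.

(** For a simple function both sides are the same finite sum, by the hypothesis
    on [nu]; monotone convergence does the rest.  The density is real valued so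
    that multiplication by [h x] is continuous. *)
Lemma ge0_integral_density (nu : {measure set T -> \bar R}) (h : T -> R)
    (k : T -> \bar R) :
  measurable_fun setT h -> (forall x, 0 <= h x)%R ->
  (forall A, measurable A -> nu A = \int[mu]_(x in A) (h x)%:E) ->
  measurable_fun setT k -> (forall x, 0 <= k x) ->
  \int[nu]_x k x = \int[mu]_x (k x * (h x)%:E).
Proof.
move=> /measurable_EFinP mh h0 nuE mk k0.
pose k_ := nnsfun_approx measurableT mk.
have mk_ n : measurable_fun setT (fun x => (k_ n x)%:E).
  exact/measurable_EFinP.
have k_0 n x : 0 <= (k_ n x)%:E by rewrite lee_fin.
have k_nd x : {homo (fun n => (k_ n x)%:E) : m n / (m <= n)%N >-> m <= n}.
  by move=> m n mn; rewrite lee_fin; exact/lefP/nd_nnsfun_approx.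
have k_cvg x : (k_ n x)%:E @[n --> \oo] --> k x by exact: cvg_nnsfun_approx.
transitivity (limn (fun n => \int[nu]_x (k_ n x)%:E)).
  rewrite -monotone_convergence//.
  by apply: eq_integral => x _; apply/esym/cvg_lim => //; exact: k_cvg.
transitivity (limn (fun n => \int[mu]_x ((k_ n x)%:E * (h x)%:E))); last first.
  rewrite -monotone_convergence//.
  - apply: eq_integral => x _; apply/cvg_lim => //.
    by apply: cvgeZr.
  - by move=> n; apply: emeasurable_funM.
  - by move=> n x _; apply: mule_ge0; rewrite ?lee_fin.
  - by move=> x _ m n mn; apply: lee_wpmul2r; rewrite ?lee_fin//; exact: k_nd.
congr (limn _); apply/funext => n.
have mpre r : measurable (k_ n @^-1` [set r]) by exact: measurable_sfunP.
under eq_integral do rewrite fimfunE -fsumEFin//.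
rewrite ge0_integral_fsum//; last 2 first.
- by move=> r; exact/measurable_EFinP/measurable_funM.
- by move=> r x _; rewrite nnfun_muleindic_ge0.
under [RHS]eq_integral.
  move=> x _; rewrite fimfunE -fsumEFin// ge0_mule_fsuml; last first.
    by move=> r; exact: nnfun_muleindic_ge0.
  over.
rewrite ge0_integral_fsum//; last 2 first.
- move=> r; apply: emeasurable_funM => //.
  by exact/measurable_EFinP/measurable_funM.
- move=> r x _; apply: mule_ge0; last by rewrite lee_fin.
  exact: nnfun_muleindic_ge0.
apply: eq_fsbigr => r _.
rewrite integralZl_indic_nnsfun// integral_indic// setIT nuE//.
have [r0|r0] := ltP r 0%R.
  rewrite preimage_nnfun0// integral_set0 mule0; apply/esym/integral0_eq => x _.
  by rewrite indic0 mulr0 mul0e.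
rewrite -ge0_integralZl//; [|exact: measurable_funTS|by move=> x _; rewrite lee_fin].
rewrite integral_mkcond; apply: eq_integral => x _.
rewrite patchE indicE; case: ifPn => xr; first by rewrite mulr1.
by rewrite mulr0 mul0e.
Qed.
End density.

Section measures.
Local Open Scope ereal_scope.

Lemma integral_density d (T : measurableType d) (R : realType)
    (mu nu : {measure set T -> \bar R}) (h : T -> R) (k : T -> \bar R) :
  measurable_fun setT h -> (forall x, 0 <= h x)%R ->
  (forall A, measurable A -> nu A = \int[mu]_(x in A) (h x)%:E) ->
  measurable_fun setT k -> \int[nu]_x k x = \int[mu]_x (k x * (h x)%:E).
Proof.
move=> mh h0 nuE mk; rewrite integralE [RHS]integralE.
rewrite !(@ge0_integral_density _ _ _ mu nu h)//; last 2 first.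
- exact: measurable_funeneg.
- exact: measurable_funepos.
have h0e x : 0 <= (h x)%:E by rewrite lee_fin.
congr (_ - _); apply: eq_integral => x _.
  by rewrite !funeposE maxe_pMl// mul0e.
by rewrite !funenegE maxe_pMl// mul0e mulNe.
Qed.

Lemma integral_mscale d (T : measurableType d) (R : realType)
    (mu : {measure set T -> \bar R}) (a : {nonneg R}) (k : T -> \bar R) :
  mu.-integrable setT k ->
  \int[mscale a mu]_x k x = a%:num%:E * \int[mu]_x k x.
Proof.
move=> ik; have mk := measurable_int _ ik.
rewrite (@integral_density _ _ _ mu (mscale a mu) (cst a%:num))//.
  under eq_integral do rewrite muleC /=.
  by rewrite integralZl.
by move=> A mA; rewrite (integral_cst mu mA (a%:num)%:E).
Qed.

(** Here and below, [m2] is the image of [m1] under [T] in the form of an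
    equation between values rather than as a [pushforward]: the surface measure
    has several such descriptions, one for each choice of the polar axis. *)
Lemma integrable_transport d1 d2 (X : measurableType d1) (Y : measurableType d2)
    (R : realType) (m1 : {measure set X -> \bar R}) (m2 : {measure set Y -> \bar R})
    (T : X -> Y) (g : Y -> \bar R) :
  measurable_fun setT T -> (forall A, measurable A -> m2 A = m1 (T @^-1` A)) ->
  m2.-integrable setT g -> m1.-integrable setT (g \o T).
Proof.
move=> mT m2E /integrableP[mg ig]; apply/integrableP.
split; first exact: measurableT_comp.
apply: le_lt_trans ig.
rewrite [leRHS](eq_measure_integral (pushforward m1 T)); last first.
  by move=> A mA _; exact: m2E.
by rewrite [leRHS]ge0_integral_pushforward ?preimage_setT//; exact: measurableT_comp.
Qed.

Lemma integral_transport d1 d2 (X : measurableType d1) (Y : measurableType d2)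
    (R : realType) (m1 : {measure set X -> \bar R}) (m2 : {measure set Y -> \bar R})
    (T : X -> Y) (g : Y -> \bar R) (D : set Y) :
  measurable_fun setT T -> (forall A, measurable A -> m2 A = m1 (T @^-1` A)) ->
  m2.-integrable setT g -> measurable D ->
  \int[m2]_(y in D) g y = \int[m1]_(x in T @^-1` D) g (T x).
Proof.
move=> mT m2E ig mD.
rewrite [LHS](eq_measure_integral (pushforward m1 T)); last first.
  by move=> A mA _; exact: m2E.
rewrite integral_pushforward//; first exact: (measurable_int m2).
apply: integrableS (integrable_transport mT m2E ig) => //.
by rewrite -[X in measurable X]setTI; exact: mT.
Qed.

Lemma integrable_fine d (T : measurableType d) (R : realType)
    (mu : {measure set T -> \bar R}) (h : T -> \bar R) :
  mu.-integrable setT h -> mu.-integrable setT (fun x => (fine (h x))%:E).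
Proof.
move=> ih; have mh := measurable_int _ ih.
apply: (le_integrable measurableT _ _ ih).
  by apply/measurable_EFinP; exact: measurableT_comp.
by move=> x _; case: (h x) => [r||] //=; rewrite normr0 leey.
Qed.

(** An integrable function is finite almost everywhere, so replacing its
    infinite values by [0] is invisible to the integral.  This is where the
    default value of a divergent half-circle integral is absorbed. *)
Lemma integral_fine d (T : measurableType d) (R : realType)
    (mu : {measure set T -> \bar R}) (h : T -> \bar R) (A : set T) :
  mu.-integrable setT h -> measurable A ->
  \int[mu]_(x in A) (fine (h x))%:E = \int[mu]_(x in A) h x.
Proof.
move=> ih mA; apply: ae_eq_integral => //.
- apply: measurable_funTS; exact: measurable_int (integrable_fine ih).
- apply: measurable_funTS; exact: measurable_int ih.
- have := integrable_ae measurableT ih; apply: filterS => x hx Ax.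
  by rewrite fineK// hx.
Qed.

Lemma has_density_dominates d (T : measurableType d) (R : realType)
    (nu : {charge set T -> \bar R}) (h : T -> R) (mu : {measure set T -> \bar R}) :
  has_density nu h mu -> nu `<< mu.
Proof.
move=> [ih nuE]; apply/null_content_dominatesP => A mA muA0.
rewrite nuE// /induced_charge; apply: null_set_integral => //.
by apply: measurable_funTS; exact: measurable_int ih.
Qed.

End measures.

Lemma integral_mrestr d (T : measurableType d) (R : realType)
    (mu : {measure set T -> \bar R}) (D : set T) (mD : measurable D)
    (k : T -> \bar R) :
  measurable_fun setT k ->
  (\int[mrestr mu mD]_x k x = \int[mu]_(x in D) k x)%E.
Proof.
move=> mk; rewrite (@integral_density _ _ _ mu _ \1_D)//.
- rewrite [RHS]integral_mkcond; apply: eq_integral => x _.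
  rewrite indicE patchE; case: ifPn => _; first by rewrite mule1.
  by rewrite mule0.
- by move=> A mA; rewrite integral_indic// setIC.
Qed.

Section density_measure.
Local Open Scope ereal_scope.
Context d (T : measurableType d) (R : realType).
Variables (mu : {measure set T -> \bar R}) (h : T -> R).
Hypotheses (mh : measurable_fun setT h) (h0 : forall x, (0 <= h x)%R).

(** The two hypotheses are arguments so that the measure structure is inferred
    from the term. *)
Definition density_measure of measurable_fun setT h & (forall x, (0 <= h x)%R) :=
  fun A => \int[mu]_(x in A) (h x)%:E.

Local Notation nu := (density_measure mh h0).

Let nu0 : nu set0 = 0. Proof. exact: integral_set0. Qed.

Let nu_ge0 A : 0 <= nu A.
Proof. by apply: integral_ge0 => x _; rewrite lee_fin. Qed.

Let nu_sigma : semi_sigma_additive nu.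
Proof.
apply: semi_sigma_additive_nng_induced => [|x]; last by rewrite lee_fin.
exact/measurable_EFinP.
Qed.

HB.instance Definition _ := isMeasure.Build _ _ _ nu nu0 nu_ge0 nu_sigma.
End density_measure.

(** * Substitution in one variable *)

Section substitution.
Local Open Scope ereal_scope.
Context {R : realType}.
Local Notation mu := (@lebesgue_measure R).

Lemma integral_deriv_itv (F f : R -> R) a b : (a <= b)%R ->
  (forall x : R, is_derive x 1%R F (f x)) -> continuous f ->
  \int[mu]_(x in `[a, b]) (f x)%:E = (F b - F a)%:E.
Proof.
rewrite le_eqVlt => /predU1P[<- _ _|ab dF cf].
  by rewrite set_itv1 integral_set1 subrr.
have cF : continuous F.
  by move=> x; apply/differentiable_continuous/derivable1_diffP.
rewrite (@continuous_FTC2 _ f F)//.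
- exact: continuous_subspaceT.
- split; first by [].
    exact: cvg_at_right_filter (cF a).
  exact: cvg_at_left_filter (cF b).
- by move=> x _; rewrite derive1E derive_val.
Qed.

(** Substitution for an arbitrary measurable integrand [k].  It says that the
    image under [F] of the measure with density [f] on [[a, b]] is Lebesgue
    measure on [[F a, F b]], and two finite measures on the line agree as soon
    as they agree on the rays [[c, +oo[]; there the intermediate value theorem
    identifies the preimage of a ray, and the fundamental theorem of calculus
    its measure. *)
Lemma ge0_integral_substitution_increasing (F f : R -> R) a b (k : R -> \bar R) :
  (a <= b)%R -> {in `[a, b]%R &, {homo F : x y / (x < y)%R}} ->
  (forall x : R, is_derive x 1%R F (f x)) -> continuous f ->
  (forall x, a <= x <= b -> 0 <= f x)%R ->
  measurable_fun setT k -> (forall x, 0 <= k x) ->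
  \int[mu]_(x in `[a, b]) (k (F x) * (f x)%:E) =
  \int[mu]_(y in `[F a, F b]) k y.
Proof.
move=> ab Finc dF cf f0 mk k0.
have cF : continuous F.
  by move=> x; apply/differentiable_continuous/derivable1_diffP.
have Fle : {in `[a, b]%R &, {mono F : x y / (x <= y)%R}}.
  exact: le_mono_in.
have aab : a \in `[a, b]%R by rewrite in_itv/= lexx.
have bab : b \in `[a, b]%R by rewrite in_itv/= lexx ab.
pose h : R -> R := (f \_ `[a, b])%R.
have mf : measurable_fun setT f by exact: continuous_measurable_fun.
have mF : measurable_fun setT F by exact: continuous_measurable_fun.
have mh : measurable_fun setT h.
  by apply/(measurable_restrictT _ _).1 => //; exact: measurable_funTS.
have h0 x : (0 <= h x)%R.
  by rewrite /h patchE; case: ifPn => // /[!inE]/=; rewrite in_itv/=; exact: f0.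
pose nu : {measure set (measurableTypeR R) -> \bar R} := density_measure mu mh h0.
pose Fm : {mfun measurableTypeR R >-> measurableTypeR R} :=
  HB.pack (F : measurableTypeR R -> measurableTypeR R)
    (isMeasurableFun.Build _ _ (measurableTypeR R) (measurableTypeR R) _ mF).
transitivity (\int[nu]_x k (F x)).
  rewrite (@ge0_integral_density _ _ _ mu _ h)//; last exact: measurableT_comp.
  rewrite [LHS]integral_mkcond; apply: eq_integral => x _.
  rewrite /h !patchE; case: ifPn => // _; rewrite mule0//.
transitivity (\int[pushforward nu Fm]_x k x).
  by rewrite ge0_integral_pushforward.
rewrite -(@integral_mrestr _ _ _ mu _ (measurable_itv `[F a, F b]))//.
apply: eq_measure_integral => A mA _.
have nuE B : nu B = \int[mu]_(x in B `&` `[a, b]) (f x)%:E.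
  rewrite integral_mkcondr; apply: eq_integral => x _.
  by rewrite /h !patchE; case: ifP.
have nuT : nu setT = (F b - F a)%:E by rewrite nuE setTI integral_deriv_itv.
apply: (@measure_unique _ R (measurableTypeR R) (@RGenCInfty.G R)
  (fun n : nat => `[(- n%:R)%R, +oo[%classic) _ _ _ _ (pushforward nu Fm)
  (mrestr mu (measurable_itv `[F a, F b]))) => //.
- exact: RGenCInfty.measurableE.
- move=> _ _ [x ->] [y ->]; exists (Num.max x y).
  by apply/seteqP; split => z /=; rewrite !in_itv/= !andbT ge_max => /andP.
- by move=> i; exists (- i%:R)%R.
- rewrite -subTset => x _; exists (Num.truncn `|x|).+1 => //=.
  rewrite in_itv/= andbT lerNl (le_trans (ler_norm _))// normrN.
  by rewrite ltW// truncnS_gt.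
- move=> _ [c ->]; rewrite /pushforward/= /mrestr.
  transitivity (\int[mu]_(x in F @^-1` `[c, +oo[ `&` `[a, b]) (f x)%:E).
    exact: nuE.
  (* the preimage of the ray in [a, b] is all of [a, b], empty, or [c', b] *)
  have [cFa|/ltW Fac] := leP c (F a).
    rewrite [X in integral _ X](_ : _ = `[a, b]%classic); last first.
      apply/seteqP; split => x /=; rewrite !in_itv/= andbT;
        [by case|move=> /andP[ax xb]].
      by rewrite ax xb (le_trans cFa)// Fle// in_itv/= ax.
    rewrite [X in _ = X](_ : _ = mu `[F a, F b]%classic); last first.
      congr (mu _); apply/seteqP; split => x /=; rewrite !in_itv/= andbT;
        [by case|move=> /andP[ax xb]].
      by rewrite ax xb (le_trans cFa).
    rewrite integral_deriv_itv// lebesgue_measure_itv/= lte_fin.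
    have := Fle _ _ aab bab; rewrite ab le_eqVlt => /orP[/eqP->|->//].
    by rewrite ltxx subrr.
  have [cFb|Fbc] := leP c (F b); last first.
    rewrite [X in integral _ X](_ : _ = set0) ?integral_set0; last first.
      apply/seteqP; split => x //=; rewrite !in_itv/= andbT => -[cx /andP[ax xb]].
      have : (F x <= F b)%R by rewrite Fle// in_itv/= ax.
      by move=> /(le_trans cx); rewrite leNgt Fbc.
    rewrite [X in _ = X](_ : _ = mu set0); first by rewrite measure0.
    congr (mu _).
    apply/seteqP; split => x //=; rewrite !in_itv/= andbT => -[cx /andP[ax xb]].
    by have := le_trans cx xb; rewrite leNgt Fbc.
  have [|c' c'ab c'E] := @IVT _ F a b c ab (continuous_subspaceT cF).
    by rewrite min_l ?max_r ?Fle// Fac.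
  have /andP[ac' c'b] : (a <= c' <= b)%R by move: c'ab; rewrite in_itv.
  rewrite [X in integral _ X](_ : _ = `[c', b]%classic); last first.
    apply/seteqP; split => x /=; rewrite !in_itv/= andbT;
      [move=> [+ /andP[ax xb]]|move=> /andP[ax xb]].
      by rewrite -c'E Fle ?xb ?andbT// in_itv/= ax.
    by rewrite xb (le_trans ac' ax) -c'E Fle// in_itv/= xb (le_trans ac').
  rewrite [X in _ = X](_ : _ = mu `[c, F b]%classic); last first.
    congr (mu _); apply/seteqP; split => x /=; rewrite !in_itv/= andbT;
      [by move=> [-> /andP[]]|move=> /andP[cx xb]].
    by rewrite cx xb (le_trans Fac).
  rewrite integral_deriv_itv// c'E lebesgue_measure_itv/= lte_fin.
  by move: cFb; rewrite le_eqVlt => /orP[/eqP->|->//]; rewrite ltxx subrr.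
- move=> n; rewrite (@le_lt_trans _ _ (nu setT))//; last by rewrite nuT ltry.
  apply: (le_measure nu) => //; rewrite inE//.
  rewrite -[X in measurable X]setTI; exact: (mF measurableT).
Qed.

Lemma ge0_integral_oppr a b (k : R -> \bar R) :
  measurable_fun setT k -> (forall x, 0 <= k x) ->
  \int[mu]_(x in `[a, b]) k (- x)%R = \int[mu]_(x in `[(- b)%R, (- a)%R]) k x.
Proof.
move=> mk k0.
have -> : `[a, b]%classic =
    (-%R : _ -> measurableTypeR R) @^-1` `[(- b)%R, (- a)%R].
  by rewrite opp_preimage_itvbndbnd !opprK.
rewrite -ge0_integral_pushforward//=; last exact: measurable_funTS.
by apply: eq_measure_integral => //= A mA AS; exact: lebesgue_measureN.
Qed.

(** The increasing case applied to [- F], followed by the reflection of the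
    line. *)
Lemma ge0_integral_substitution_decreasing (F f : R -> R) a b (k : R -> \bar R) :
  (a <= b)%R -> {in `[a, b]%R &, {homo F : x y /~ (x < y)%R}} ->
  (forall x : R, is_derive x 1%R F (- f x)%R) -> continuous f ->
  (forall x, a <= x <= b -> 0 <= f x)%R ->
  measurable_fun setT k -> (forall x, 0 <= k x) ->
  \int[mu]_(x in `[a, b]) (k (F x) * (f x)%:E) =
  \int[mu]_(y in `[F b, F a]) k y.
Proof.
move=> ab Fdec dF cf f0 mk k0.
pose G x := (- F x)%R.
have dG (x : R) : is_derive x 1%R G (f x).
  by rewrite -[f x]opprK; exact: is_deriveN.
have := @ge0_integral_substitution_increasing G f a b (k \o -%R) ab.
rewrite /G ge0_integral_oppr// !opprK => <- //.
- by apply: eq_integral => x _ /=; rewrite opprK.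
- by move=> x y xab yab xy; rewrite ltrN2; exact: Fdec.
- by apply: measurableT_comp.
- by move=> x; exact: k0.
Qed.
End substitution.

(** * The measures of the two angles *)

Section circle_integral.
Local Open Scope ereal_scope.
Context {R : realType}.
Local Notation mu := (@lebesgue_measure R).

Lemma integral_sigma_T (k : circle R -> \bar R) :
  measurable_fun setT k -> (forall c, 0 <= k c) ->
  \int[sigma_T R]_c k c = \int[mu]_(t in `[0%R, (2 * pi)%R]) k (angle t).
Proof.
move=> mk k0.
have mka : measurable_fun setT (k \o @angle R).
  exact: measurableT_comp mk (@measurable_angle R).
rewrite -integral_itv_bndo_bndc; last exact: measurable_funTS.
rewrite -(@integral_mrestr _ _ _ mu _ (measurable_itv `[0%R, (2 * pi)%R[))//.
by rewrite /sigma_T /mpushforward ge0_integral_pushforward.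
Qed.

Lemma integral_sin_measure (k : R -> \bar R) :
  measurable_fun setT k ->
  \int[@sin_measure R]_t k t = \int[mu]_(t in `[0%R, pi]) (k t * (sin t)%:E).
Proof.
move=> mk.
pose h : R -> R := ((@sin R) \_ `[0, pi])%R.
rewrite (@integral_density _ _ _ mu (@sin_measure R) h)//.
- rewrite [RHS]integral_mkcond; apply: eq_integral => t _.
  by rewrite /h !patchE; case: ifP => // _; rewrite mule0.
- apply/(measurable_restrictT _ _).1 => //.
  by apply: measurable_funTS; exact: measurable_sin.
- move=> t; rewrite /h patchE; case: ifPn => // /[!inE]/=; rewrite in_itv/=.
  exact: sin_ge0_pi.
- move=> A mA; rewrite [LHS]integral_mkcondr; apply: eq_integral => t _.
  by rewrite /h !patchE; case: ifP.
Qed.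

Lemma ge0_integral_addr (a b s : R) (k : R -> \bar R) :
  (a <= b)%R -> measurable_fun setT k -> (forall x, 0 <= k x) ->
  \int[mu]_(x in `[a, b]) k (x + s)%R =
  \int[mu]_(x in `[(a + s)%R, (b + s)%R]) k x.
Proof.
move=> ab mk k0.
have dF (x : R) : is_derive x 1%R (+%R^~ s)%R (cst 1%R x).
  by apply: is_derive_eq; rewrite addr0.
rewrite -(@ge0_integral_substitution_increasing _ (+%R^~ s) (cst 1%R) a b k)//.
- by apply: eq_integral => x _ /=; rewrite mule1.
- by move=> x y _ _ xy; rewrite ltrD2r.
- exact: cst_continuous.
Qed.

Lemma ge0_integral_itv_split (a b c : R) (k : R -> \bar R) :
  (a <= b)%R -> (b <= c)%R -> measurable_fun setT k -> (forall x, 0 <= k x) ->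
  \int[mu]_(x in `[a, c]) k x =
  \int[mu]_(x in `[a, b]) k x + \int[mu]_(x in `[b, c]) k x.
Proof.
move=> ab bc mk k0.
rewrite (@itv_bndbnd_setU _ _ _ (BLeft b))//.
rewrite ge0_integral_setU//=.
- by rewrite integral_itv_bndo_bndc//; exact: measurable_funTS.
- exact: measurable_funTS.
- apply/disj_set2P; rewrite -subset0 => x/=; rewrite !in_itv/= => -[/andP[_]].
  by rewrite ltNge => /negbTE ->.
Qed.

(** The part of [[s, s + 2 pi]] beyond [2 pi] is moved back by one period. *)
Lemma ge0_integral_periodic (s : R) (k : R -> \bar R) :
  (0 <= s <= 2 * pi)%R -> measurable_fun setT k -> (forall x, 0 <= k x) ->
  (forall x, k (x + 2 * pi)%R = k x) ->
  \int[mu]_(x in `[0%R, (2 * pi)%R]) k (x + s)%R =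
  \int[mu]_(x in `[0%R, (2 * pi)%R]) k x.
Proof.
move=> /andP[s0 s2] mk k0 kp; have s02 := le_trans s0 s2.
rewrite ge0_integral_addr// add0r.
rewrite (@ge0_integral_itv_split _ (2 * pi)%R)//; last by rewrite lerDl.
rewrite [RHS](@ge0_integral_itv_split _ s)// addeC; congr (_ + _).
transitivity (\int[mu]_(x in `[0%R, s]) k (x + 2 * pi)%R).
  by rewrite ge0_integral_addr// add0r addrC.
by apply: eq_integral => x _; rewrite kp.
Qed.

Lemma angle_surj (c : circle R) : exists2 s : R, (0 <= s <= 2 * pi)%R & angle s = c.
Proof.
have p0 : (0 < 2 * pi :> R)%R by rewrite mulr_gt0// pi_gt0.
pose k : int := Num.floor (repr c / (2 * pi))%R.
exists (repr c - 2 * pi * k%:~R)%R.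
  have /andP[] := floor_itv (repr c / (2 * pi))%R; rewrite -/k.
  rewrite ler_pdivlMr// ltr_pdivrMr// rmorphD/= mulrDl mul1r => h1 h2.
  by apply/andP; split; lra.
rewrite -[RHS]angle_repr; apply/angleP/asboolP; exists (- k)%R.
by rewrite rmorphN/= mulrN addrAC subrr add0r.
Qed.

Lemma angleD2pi (t : R) : angle (t + 2 * pi)%R = angle t.
Proof.
by apply/angleP/asboolP; exists 1%R; rewrite mulr1 addrAC subrr add0r.
Qed.

End circle_integral.

(** * Points and rotations of the sphere *)

Section sphere_points.
Context {R : realType}.
Local Notation S2 := (S2 R).

Definition sphere_col (X Y Z : R) : 'cV[R]_3 :=
  mx_of_rows 3 1 [:: [:: X]; [:: Y]; [:: Z]].

(** Off the sphere the value is a default.  A total function of three real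
    variables makes integrands on the sphere into functions on the plane, to
    which Tonelli's theorem applies. *)
Definition sphere_pt (X Y Z : R) : S2 := insubd (point : S2) (sphere_col X Y Z).

Lemma sphere_colP X Y Z :
  (sphere_col X Y Z \in @unit_sphere R) = (X ^+ 2 + Y ^+ 2 + Z ^+ 2 == 1).
Proof.
by apply/idP/eqP; rewrite inE /unit_sphere/= !big_ord_recl big_ord0 !mxE/=
  addr0 addrA.
Qed.

Lemma val_sphere_pt X Y Z : X ^+ 2 + Y ^+ 2 + Z ^+ 2 = 1 ->
  \val (sphere_pt X Y Z) = sphere_col X Y Z.
Proof. by move=> h; rewrite val_insubd sphere_colP h eqxx. Qed.

Lemma S2_ext (x y : S2) : \val x 0 0 = \val y 0 0 ->
  \val x 1 0 = \val y 1 0 -> \val x 2%:R 0 = \val y 2%:R 0 -> x = y.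
Proof.
move=> e0 e1 e2; apply/val_inj/matrixP => i j; rewrite ord1.
case: i => [[|[|[|//]]] p].
- by have -> : Ordinal p = 0 :> 'I_3 by exact: val_inj.
- by have -> : Ordinal p = 1 :> 'I_3 by exact: val_inj.
- by have -> : Ordinal p = 2%:R :> 'I_3 by exact: val_inj.
Qed.

Lemma measurable_sphere_pt d (T : measurableType d) (X Y Z : T -> R) :
  measurable_fun setT X -> measurable_fun setT Y -> measurable_fun setT Z ->
  measurable_fun setT (fun t => sphere_pt (X t) (Y t) (Z t)).
Proof.
move=> mX mY mZ; apply: borel_S2 => i.
have -> : (fun t => \val (sphere_pt (X t) (Y t) (Z t)) i 0) = fun t =>
    if X t ^+ 2 + Y t ^+ 2 + Z t ^+ 2 == 1 then sphere_col (X t) (Y t) (Z t) i 0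
    else \val (point : S2) i 0.
  by apply/funext => t; rewrite val_insubd sphere_colP; case: ifP.
apply: measurable_fun_ifT; last exact: measurable_cst.
  apply: measurable_fun_eqr; last exact: measurable_cst.
  by do 2?[apply: measurable_funD]; apply: measurable_funX.
under eq_fun do rewrite mxE.
by case: i => [[|[|[|//]]] ?].
Qed.

Definition swap_xz (x : S2) : S2 :=
  sphere_pt (\val x 2%:R 0) (\val x 1 0) (\val x 0 0).

Lemma val_swap_xz x : \val (swap_xz x) =
  sphere_col (\val x 2%:R 0) (\val x 1 0) (\val x 0 0).
Proof. by rewrite val_sphere_pt// -(S2_coord x); ring. Qed.

Lemma measurable_swap_xz : measurable_fun setT swap_xz.
Proof. by apply: measurable_sphere_pt; exact: measurable_S2_coord. Qed.

Lemma R3_angle0 : R3 (angle 0) = 1%:M :> 'M[R]_3.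
Proof.
apply/matrixP => i j; rewrite !mxE cosT_angle sinT_angle cos0 sin0 oppr0.
by case: i => [[|[|[|//]]] ?]; case: j => [[|[|[|//]]] ?].
Qed.

Lemma R2_0 : R2 0 = 1%:M :> 'M[R]_3.
Proof.
apply/matrixP => i j; rewrite !mxE cos0 sin0 oppr0.
by case: i => [[|[|[|//]]] ?]; case: j => [[|[|[|//]]] ?].
Qed.

Definition rotZ (s : R) : SO3 R := Psi (angle s) 0 (angle 0).

Lemma rotateZE s x : \val (rotate (rotZ s) x) = sphere_col
  (cos s * \val x 0 0 - sin s * \val x 1 0)
  (sin s * \val x 0 0 + cos s * \val x 1 0) (\val x 2%:R 0).
Proof.
apply/matrixP => i j; rewrite ord1 /=.
rewrite R2_0 R3_angle0 !mulmx1.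
rewrite !mxE !big_ord_recl big_ord0 !mxE.
have -> : lift ord0 (lift ord0 ord0) = 2%:R :> 'I_3 by apply/val_inj.
have -> : lift ord0 ord0 = 1 :> 'I_3 by apply/val_inj.
rewrite !cosT_angle !sinT_angle.
by case: i => [[|[|[|//]]] ?] /=; ring.
Qed.

Lemma rotateZ_Phi s u t : rotate (rotZ s) (Phi (angle u) t) = Phi (angle (u + s)) t.
Proof.
by apply: S2_ext; rewrite rotateZE !mxE/= ?cosT_angle ?sinT_angle ?cosD ?sinD; ring.
Qed.

Lemma rotateYE b x : \val (rotate (Psi (angle 0) b (angle 0)) x) = sphere_col
  (cos b * \val x 0 0 + sin b * \val x 2%:R 0) (\val x 1 0)
  (- sin b * \val x 0 0 + cos b * \val x 2%:R 0).
Proof.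
apply/matrixP => i j; rewrite ord1 /=.
rewrite R3_angle0 mulmx1 mul1mx.
rewrite !mxE !big_ord_recl big_ord0 !mxE.
have -> : lift ord0 (lift ord0 ord0) = 2%:R :> 'I_3 by apply/val_inj.
have -> : lift ord0 ord0 = 1 :> 'I_3 by apply/val_inj.
by case: i => [[|[|[|//]]] ?] /=; ring.
Qed.

(** The exchange of [x] and [z] conjugates rotations about the [z]-axis into
    rotations about the [x]-axis, and a quarter turn about the [z]-axis
    conjugates the latter into rotations about the [y]-axis.  The sign of [b]
    changes because the exchange reverses orientation. *)
Lemma rotateY_swap b x : rotate (Psi (angle 0) b (angle 0)) x =
  rotate (rotZ (pi / 2)) (swap_xz (rotate (rotZ (- b))
    (swap_xz (rotate (rotZ (- (pi / 2))) x)))).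
Proof.
pose co (y : S2) := (\val y 0 0, \val y 1 0, \val y 2%:R 0).
have co_inj y y' : co y = co y' -> y = y' by case; exact: S2_ext.
have coZ s y : co (rotate (rotZ s) y) = (cos s * (co y).1.1 - sin s * (co y).1.2,
    sin s * (co y).1.1 + cos s * (co y).1.2, (co y).2).
  by rewrite {1}/co rotateZE !mxE.
have coY y : co (rotate (Psi (angle 0) b (angle 0)) y) =
    (cos b * (co y).1.1 + sin b * (co y).2, (co y).1.2,
     - sin b * (co y).1.1 + cos b * (co y).2).
  by rewrite {1}/co rotateYE !mxE.
have coS y : co (swap_xz y) = ((co y).2, (co y).1.2, (co y).1.1).
  by rewrite {1}/co val_swap_xz !mxE.
clearbody co; apply: co_inj; rewrite coY !(coZ, coS)/=.
rewrite !cosN !sinN cos_pihalf sin_pihalf.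
by congr (_, _, _); ring.
Qed.

Lemma rotate_Psi0 a b (x : S2) : rotate (Psi a b (angle 0)) x =
  rotate (Psi a 0 (angle 0)) (rotate (Psi (angle 0) b (angle 0)) x).
Proof.
apply/val_inj => /=; rewrite mulmxA; congr (_ *m _).
by rewrite R3_angle0 R2_0 !mulmx1 mul1mx.
Qed.

Lemma measurable_rotate (Q : SO3 R) : measurable_fun setT (rotate Q).
Proof.
apply: borel_S2 => i /=; apply: measurable_mulmx => {i} [i j|i j].
  exact: measurable_cst.
by rewrite ord1; exact: measurable_S2_coord.
Qed.

End sphere_points.

(** * Rotation invariance of the surface measure *)

Section invariant.
Local Open Scope ereal_scope.
Context d (X : measurableType d) (R : realType) (m : {measure set X -> \bar R}).

(** Stated for integrals because that is how spherical coordinates and Tonelli's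
    theorem enter; [invariant_preimage] returns to sets. *)
Definition measure_invariant (T : X -> X) := measurable_fun setT T /\
  forall g : X -> \bar R, measurable_fun setT g -> (forall x, 0 <= g x) ->
  \int[m]_x g (T x) = \int[m]_x g x.

Lemma invariant_comp T1 T2 : measure_invariant T1 -> measure_invariant T2 ->
  measure_invariant (fun x => T1 (T2 x)).
Proof.
move=> [m1 i1] [m2 i2]; split; first exact: measurableT_comp.
move=> g mg g0; rewrite (i2 (fun x => g (T1 x)))//; first exact: i1.
exact: measurableT_comp.
Qed.

Lemma invariant_preimage T A :
  measure_invariant T -> measurable A -> m (T @^-1` A) = m A.
Proof.
move=> [mT iT] mA.
have mTA : measurable (T @^-1` A).
  by rewrite -[X in measurable X]setTI; exact: mT.
transitivity (\int[m]_x (\1_A (T x))%:E).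
  by rewrite (integral_indic m measurableT mTA) setIT.
rewrite (iT (fun x => (\1_A x)%:E)) => [||x]; last by rewrite lee_fin.
  by rewrite integral_indic// setIT.
exact/measurable_EFinP.
Qed.
End invariant.

Section sphere_integral.
Local Open Scope ereal_scope.
Context {R : realType}.
Local Notation S2 := (S2 R).
Local Notation mu := (@lebesgue_measure R).

Lemma integral_sigma_S2 (g : S2 -> \bar R) :
  measurable_fun setT g -> (forall x, 0 <= g x) ->
  \int[sigma_S2 R]_x g x = \int[sigma_T R]_c \int[@sin_measure R]_t g (Phi c t).
Proof.
move=> mg g0.
have mgP : measurable_fun setT (g \o @Phi2 R).
  exact: measurableT_comp mg (@measurable_Phi R).
rewrite /sigma_S2 /mpushforward ge0_integral_pushforward//.
by rewrite preimage_setT (fubini_tonelli1 _ mgP) => [|p]; [|exact: g0].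
Qed.

Lemma measurable_sqrt_inv d (T : measurableType d) (h : T -> R) :
  measurable_fun setT h ->
  measurable_fun setT (fun x => Num.sqrt (h x)) /\
  measurable_fun setT (fun x => (Num.sqrt (h x))^-1)%R.
Proof.
move=> mh.
have ms : measurable_fun setT (@Num.sqrt R).
  by apply: continuous_measurable_fun; exact: sqrt_continuous.
have msh := measurableT_comp ms mh; split=> //.
under eq_fun do rewrite -powR_inv1 ?sqrtr_ge0//.
exact: measurableT_comp (measurable_powR _) msh.
Qed.

Local Notation invariant := (measure_invariant (sigma_S2 R)).

Lemma invariant_rotateZ a : invariant (rotate (Psi a 0%R (angle 0))).
Proof.
split=> [|g mg g0]; first exact: measurable_rotate.
have [s s2 <-] := angle_surj a; rewrite -/(rotZ s).
have mgr : measurable_fun setT (fun x => g (rotate (rotZ s) x)).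
  by apply: measurableT_comp mg _; exact: measurable_rotate.
pose G c := \int[@sin_measure R]_t g (Phi c t).
have mgP : measurable_fun setT (g \o @Phi2 R).
  exact: measurableT_comp mg (@measurable_Phi R).
have mG : measurable_fun setT G.
  by apply: (measurable_fun_fubini_tonelli_F _ mgP) => p; exact: g0.
have mGr : measurable_fun setT
    (fun c => \int[@sin_measure R]_t g (rotate (rotZ s) (Phi c t))).
  apply: (measurable_fun_fubini_tonelli_F
    (fun p => g (rotate (rotZ s) (Phi2 p)))) => [|p].
    exact: measurableT_comp mgr (@measurable_Phi R).
  exact: g0.
have mGa : measurable_fun setT (G \o @angle R).
  exact: measurableT_comp mG (@measurable_angle R).
have G0 c : 0 <= G c by exact: integral_ge0.
rewrite (integral_sigma_S2 mgr (fun x => g0 _)) (integral_sigma_S2 mg g0).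
apply: etrans (etrans _ (esym (integral_sigma_T mG G0))).
  by apply: (integral_sigma_T mGr) => c; exact: integral_ge0.
rewrite -[RHS](@ge0_integral_periodic _ s (G \o @angle R))//.
- by apply: eq_integral => u _; apply: eq_integral => t _; rewrite rotateZ_Phi.
- by move=> u; exact: integral_ge0.
- by move=> u /=; rewrite angleD2pi.
Qed.

(** In the coordinates [x] and [z], each of the hemispheres [y > 0] and [y < 0]
    is a graph over the unit disc, on which the surface measure has the density
    [1 / |y|].  On the boundary and outside of the disc [r] is [0], hence so is
    [r^-1], and the formula vanishes there by itself. *)
Definition slice_density (g : S2 -> \bar R) (z x : R) : \bar R :=
  let r := Num.sqrt (1 - x ^+ 2 - z ^+ 2) in
  (g (sphere_pt x r z) + g (sphere_pt x (- r) z)) * (r^-1)%:E.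

Lemma slice_density_ge0 g z x : (forall p, 0 <= g p) -> 0 <= slice_density g z x.
Proof.
move=> g0; apply: mule_ge0; first by rewrite adde_ge0.
by rewrite lee_fin invr_ge0 sqrtr_ge0.
Qed.

Lemma measurable_slice_density g : measurable_fun setT g ->
  measurable_fun setT (fun p : measurableTypeR R * measurableTypeR R =>
    slice_density g p.1 p.2).
Proof.
move=> mg.
have mx := @measurable_snd _ _ (measurableTypeR R) (measurableTypeR R).
have mz := @measurable_fst _ _ (measurableTypeR R) (measurableTypeR R).
have [|mr mri] := @measurable_sqrt_inv _ _
    (fun p : measurableTypeR R * measurableTypeR R => 1 - p.2 ^+ 2 - p.1 ^+ 2)%R.
  apply: measurable_funB; last exact: measurable_funX.
  by apply: measurable_funB => //; exact: measurable_funX.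
apply: emeasurable_funM.
  apply: emeasurable_funD; apply: measurableT_comp mg _;
    apply: measurable_sphere_pt => //.
  exact: measurableT_comp mr.
exact/measurable_EFinP.
Qed.

(** The weight is symmetric in [x] and [z], and where it is not [0] the two
    points of the definition lie on the sphere, so that the exchange really
    acts on their coordinates. *)
Lemma slice_density_swap g z x : slice_density (g \o swap_xz) z x = slice_density g x z.
Proof.
rewrite /slice_density addrAC; set r := Num.sqrt _.
have [->|r0] := eqVneq r 0%R; first by rewrite invr0 !mule0.
have e : (r ^+ 2 = 1 - z ^+ 2 - x ^+ 2)%R.
  rewrite sqr_sqrtr// leNgt; apply: contra r0 => h.
  by rewrite /r ler0_sqrtr// ltW.
have E (y : R) : (y ^+ 2 = r ^+ 2)%R -> swap_xz (sphere_pt x y z) = sphere_pt z y x.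
  move=> y2; have h : (x ^+ 2 + y ^+ 2 + z ^+ 2 = 1)%R by rewrite y2 e; ring.
  have h' : (z ^+ 2 + y ^+ 2 + x ^+ 2 = 1)%R by rewrite y2 e; ring.
  by apply: S2_ext; rewrite val_swap_xz !val_sphere_pt// !mxE.
by rewrite /= !E// sqrrN.
Qed.

(** On the circle of latitude of radius [s = sin t], substitute
    [x = s * cos u] separately on [0 <= u <= pi] and [pi <= u <= 2 * pi], where
    [y = s * sin u] has a constant sign; then [dx] is [|y| du] up to sign, which
    produces the weight [1 / |y|]. *)
Lemma integral_circle_slice (g : S2 -> \bar R) (t : R) :
  measurable_fun setT g -> (forall x, 0 <= g x) -> (0 < t < pi)%R ->
  \int[sigma_T R]_c g (Phi c t) = \int[mu]_x slice_density g (cos t) x.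
Proof.
move=> mg g0 t0pi.
have s0 := sin_gt0_pi t0pi; set s := sin t in s0.
set z := cos t.
have zE : (1 - z ^+ 2 = s ^+ 2)%R by rewrite /z /s sin2cos2.
pose r (x : R) : R := Num.sqrt (1 - x ^+ 2 - z ^+ 2).
pose k (e : R) (x : R) := g (sphere_pt x (e * r x) z) * ((r x)^-1)%:E.
have [|mr mri] := @measurable_sqrt_inv _ _ (fun x : R => 1 - x ^+ 2 - z ^+ 2)%R.
  apply: measurable_funB => //.
  by apply: measurable_funB => //; exact: measurable_funX.
have mk e : measurable_fun setT (k e).
  apply: emeasurable_funM.
    apply: measurableT_comp mg _; apply: measurable_sphere_pt => //.
    exact: measurable_funM.
  exact/measurable_EFinP.
have k0 e x : 0 <= k e x.
  by apply: mule_ge0; rewrite ?lee_fin ?invr_ge0 ?sqrtr_ge0.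
have slE x : slice_density g z x = k 1%R x + k (-1)%R x.
  rewrite /slice_density -/(r x) /k mul1r mulN1r ge0_muleDl//.
(* r is the modulus of the y-coordinate, and e is its sign *)
have rE u : r (s * cos u)%R = (s * `|sin u|)%R.
  rewrite /r addrAC zE exprMn -{1}[(s ^+ 2)%R]mulr1 -mulrBr -sin2cos2 -exprMn.
  by rewrite sqrtr_sqr normrM gtr0_norm.
have mgP : measurable_fun setT (fun u : R => g (Phi (angle u) t)).
  apply: measurableT_comp mg _; apply: measurable_fun_Phi => //.
  exact: measurable_angle.
have PhiE (e u : R) : sin u != 0%R -> (sin u = e * `|sin u|)%R ->
    g (Phi (angle u) t) = k e (s * cos u)%R * (s * `|sin u|)%:E.
  move=> su0 sue; rewrite /k rE -muleA -EFinM mulVf ?mule1; last first.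
    by rewrite mulf_neq0 ?gt_eqF// normr_gt0.
  have y2 : (e * (s * `|sin u|) = s * sin u)%R by rewrite mulrCA -sue.
  have p1 : ((s * cos u) ^+ 2 + (s * sin u) ^+ 2 + z ^+ 2 = 1)%R.
    by rewrite !exprMn -mulrDr cos2Dsin2 mulr1 -zE subrK.
  congr g; apply: S2_ext; rewrite val_sphere_pt ?mxE/= ?cosT_angle ?sinT_angle
    ?y2//; by rewrite mulrC.
have pi2 : (pi <= 2 * pi :> R)%R by rewrite ler_peMl ?pi_ge0// ler1n.
rewrite integral_sigma_T//; last first.
  apply: measurableT_comp mg _; apply: measurable_fun_Phi => //.
rewrite (@ge0_integral_itv_split _ 0%R pi) ?pi_ge0//.
have -> : \int[mu]_x slice_density g z x =
    \int[mu]_(x in `[(- s)%R, s]) slice_density g z x.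
  rewrite [RHS]integral_mkcond; apply: eq_integral => x _; rewrite patchE.
  case: ifPn => //; rewrite notin_setE/= in_itv/= -ler_norml => /negP.
  rewrite -ltNge => sx; rewrite slE /k.
  have -> : r x = 0%R.
    rewrite /r addrAC zE ler0_sqrtr// subr_le0.
    by rewrite -[leRHS]real_normK ?num_real// lerXn2r ?nnegrE ?(ltW s0)// ltW.
  by rewrite invr0 !mule0 adde0.
under [RHS]eq_integral do rewrite slE.
rewrite ge0_integralD//; try by [apply: measurable_funTS; exact: mk|move=> ? _; exact: k0].
have dF (u : R) : is_derive u 1%R (fun u => s * cos u)%R (- (s * sin u))%R.
  by apply: is_derive_eq; rewrite -mulrN.
have mgPo (a b : R) : measurable_fun `]a, b[ (fun u : R => g (Phi (angle u) t)).
  exact: measurable_funTS.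
have mko e (w : R -> R) (a b : R) : continuous w ->
    measurable_fun `]a, b[ (fun u : R => k e (s * cos u)%R * (w u)%:E).
  move=> cw; apply: measurable_funTS; apply: emeasurable_funM.
    apply: measurableT_comp => //; apply: measurable_funM => //.
    exact: measurable_cos.
  by apply/measurable_EFinP; exact: continuous_measurable_fun.
have csin : continuous (fun u : R => s * sin u)%R.
  by move=> ?; apply: cvgM; [exact: cvg_cst|exact: continuous_sin].
congr (_ + _).
- have := @ge0_integral_substitution_decreasing _ (fun u => s * cos u)%R
    (fun u => s * sin u)%R 0%R pi (k 1%R) (pi_ge0 R).
  rewrite cospi cos0 mulr1 mulrN1 => <- //; last 2 first.
  + by move=> x y x0 y0 xy; rewrite ltr_pM2l// ltr_cos.
  + by move=> u u0; rewrite mulr_ge0 ?(ltW s0)// sin_ge0_pi.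
  rewrite integral_itv_bndoo// [RHS]integral_itv_bndoo//; last exact: mko.
  apply: eq_integral => u; rewrite inE/= in_itv/= => /sin_gt0_pi su.
  rewrite (@PhiE 1%R) ?gt_eqF// gtr0_norm// ?mul1r//.
- have := @ge0_integral_substitution_increasing _ (fun u => s * cos u)%R
    (fun u => - (s * sin u))%R pi (2 * pi)%R (k (-1)%R) pi2.
  have cosE (u : R) : cos u = (- cos (u - pi))%R by rewrite -cosDpi subrK.
  have sinE (u : R) : sin u = (- sin (u - pi))%R by rewrite -sinDpi subrK.
  have cos2pi : cos (2 * pi : R)%R = 1%R.
    by rewrite mulr_natl -[X in cos X]add0r cosD2pi cos0.
  rewrite cospi cos2pi mulr1 mulrN1 => <- //; last 3 first.
  + move=> x y; rewrite !in_itv/= => /andP[x1 x2] /andP[y1 y2] xy.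
    rewrite ltr_pM2l// (cosE x) (cosE y) ltrN2 ltr_cos ?in_itv/=; lra.
  + by move=> ?; apply: cvgN; exact: csin.
  + move=> u /andP[u1 u2]; rewrite sinE mulrN opprK.
    by rewrite mulr_ge0 ?(ltW s0)// sin_ge0_pi//; apply/andP; split; lra.
  rewrite integral_itv_bndoo// [RHS]integral_itv_bndoo//; last first.
    by apply: mko => ?; apply: cvgN; exact: csin.
  apply: eq_integral => u; rewrite inE/= in_itv/= => /andP[u1 u2].
  have su : (sin u < 0)%R.
    by rewrite sinE oppr_lt0 sin_gt0_pi//; apply/andP; split; lra.
  by rewrite (@PhiE (-1)%R) ?lt_eqF// ltr0_norm// ?mulN1r ?opprK// mulrN.
Qed.

(** Integrate [integral_circle_slice] over the latitudes with the substitution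
    [z = cos t], which turns [sin t dt] into [dz].  The poles, where the
    circle of latitude degenerates, have measure zero. *)
Lemma integral_sphere_slices (g : S2 -> \bar R) :
  measurable_fun setT g -> (forall x, 0 <= g x) ->
  \int[sigma_S2 R]_x g x = \int[mu]_z \int[mu]_x slice_density g z x.
Proof.
move=> mg g0.
have mgP : measurable_fun setT (g \o @Phi2 R).
  exact: measurableT_comp mg (@measurable_Phi R).
pose G t := \int[sigma_T R]_c g (Phi c t).
pose J z := \int[mu]_x slice_density g z x.
have mG : measurable_fun setT G.
  by apply: (measurable_fun_fubini_tonelli_G _ mgP) => p; exact: g0.
have mJ : measurable_fun setT J.
  apply: (measurable_fun_fubini_tonelli_F _ (measurable_slice_density mg)) => p.
  exact: slice_density_ge0.
have G0 t : 0 <= G t by exact: integral_ge0.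
have J0 z : 0 <= J z by apply: integral_ge0 => x _; exact: slice_density_ge0.
rewrite integral_sigma_S2//.
rewrite (fubini_tonelli _ mgP) => [|p]; last exact: g0.
transitivity (\int[@sin_measure R]_t G t); first by [].
rewrite integral_sin_measure//.
have cs : continuous (@sin R) by exact: continuous_sin.
transitivity (\int[mu]_(t in `[0%R, pi]) (J (cos t) * (sin t)%:E)).
  rewrite [LHS]integral_itv_bndoo; last first.
    apply: measurable_funTS; apply: emeasurable_funM => //.
    by apply/measurable_EFinP; exact: measurable_sin.
  rewrite [RHS]integral_itv_bndoo; last first.
    apply: measurable_funTS; apply: emeasurable_funM.
      exact: measurableT_comp mJ (@measurable_cos R).
    by apply/measurable_EFinP; exact: measurable_sin.
  apply: eq_integral => t; rewrite inE/= in_itv/= => t0pi.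
  by rewrite /G integral_circle_slice.
rewrite (@ge0_integral_substitution_decreasing _ (@cos R) (@sin R) 0%R pi J)//.
- rewrite cospi cos0 integral_mkcond; apply: eq_integral => z _; rewrite patchE.
  case: ifPn => //; rewrite notin_setE/= in_itv/= -ler_norml => /negP.
  rewrite -ltNge => z1; apply/esym/integral0_eq => x _.
  rewrite /slice_density ler0_sqrtr ?invr0 ?mule0//.
  rewrite -addrA -opprD subr_le0 -[leLHS]addr0 addrC lerD ?sqr_ge0//.
  by rewrite -[leRHS]real_normK ?num_real// exprn_ege1// ltW.
- exact: pi_ge0.
- by move=> x y x0 y0 xy; rewrite ltr_cos.
- exact: sin_ge0_pi.
Qed.

Lemma invariant_swap : invariant swap_xz.
Proof.
split=> [|g mg g0]; first exact: measurable_swap_xz.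
have mgs : measurable_fun setT (g \o swap_xz).
  by apply: measurableT_comp mg _; exact: measurable_swap_xz.
rewrite (integral_sphere_slices mg g0).
rewrite (integral_sphere_slices mgs (fun x => g0 (swap_xz x))).
have ms := measurable_slice_density mg.
have FT := @fubini_tonelli _ _ _ _ _ mu mu _ ms (fun p => slice_density_ge0 _ _ g0).
apply: etrans (esym FT).
by apply: eq_integral => z _; apply: eq_integral => x _; exact: slice_density_swap.
Qed.

(** The rotations about the [z]-axis and the exchange of [x] and [z] generate
    all rotations that occur. *)
Lemma invariant_rotate a b : invariant (rotate (Psi a b (angle 0))).
Proof.
have -> : rotate (Psi a b (angle 0)) = fun x => rotate (Psi a 0%R (angle 0))
    (rotate (rotZ (pi / 2)) (swap_xz (rotate (rotZ (- b)%R)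
    (swap_xz (rotate (rotZ (- (pi / 2))%R) x))))).
  by apply/funext => x; rewrite rotate_Psi0 rotateY_swap.
have iZ s : invariant (rotate (rotZ s)) by exact: invariant_rotateZ.
have iS := invariant_swap.
apply: (invariant_comp (invariant_rotateZ a)).
apply: (invariant_comp (iZ _)); apply: (invariant_comp iS).
by apply: (invariant_comp (iZ _)); apply: (invariant_comp iS).
Qed.

End sphere_integral.

(** * Integration along fibres *)

Section disintegrations.
Local Open Scope ereal_scope.

(** [P] parametrizes [X] by a product, and off a null set of the second
    parameter [F] recovers the first one: the sets [P (c, _)] are the fibres of
    [F].  Then the image under [F] of the measure with density [g] has as its
    density the integral of [g] along the fibres. *)
Section disintegration.
Context d1 d2 d3 (X : measurableType d1) (C : measurableType d2)
  (I : measurableType d3) (R : realType).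
Variables (m : {measure set X -> \bar R}).
Variables (p : {sigma_finite_measure set C -> \bar R}).
Variables (q : {sigma_finite_measure set I -> \bar R}).
Variables (P : C * I -> X) (F : X -> C) (N : set I) (g : X -> \bar R).
Hypotheses (mP : measurable_fun setT P) (mF : measurable_fun setT F).
Hypothesis mE : forall A, measurable A -> m A = (p \x q) (P @^-1` A).
Hypotheses (mN : measurable N) (qN : q N = 0).
Hypothesis FP : forall c t, ~ N t -> F (P (c, t)) = c.
Hypothesis ig : m.-integrable setT g.

Let igP : (p \x q).-integrable setT (g \o P).
Proof. exact: integrable_transport ig. Qed.

Lemma integrable_fiber : p.-integrable setT (fun c => \int[q]_t g (P (c, t))).
Proof. exact: integrable_fubini_F igP. Qed.

Lemma integral_fiber A : measurable A ->
  \int[m]_(x in F @^-1` A) g x = \int[p]_(c in A) \int[q]_t g (P (c, t)).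
Proof.
move=> mA.
have mFA : measurable (F @^-1` A).
  by rewrite -[X in measurable X]setTI; exact: mF.
have mPFA : measurable (P @^-1` (F @^-1` A)).
  by rewrite -[X in measurable X]setTI; exact: mP.
rewrite (integral_transport mP mE ig mFA) integral_mkcond.
have igPA : (p \x q).-integrable setT ((g \o P) \_ (P @^-1` (F @^-1` A))).
  apply/(integrable_mkcond _ mPFA).1; exact: integrableS igP.
rewrite -(integral12_prod_meas1 igPA) [RHS]integral_mkcond.
apply: eq_integral => c _; rewrite /fubini_F patchE.
have mgc : measurable_fun setT (fun t => g (P (c, t))).
  by apply: (measurableT_comp (measurable_int _ igP)); exact: measurable_pair1.
have -> : (if c \in A then \int[q]_t g (P (c, t)) else 0) =
    \int[q]_t (if c \in A then g (P (c, t)) else 0).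
  by case: ifP => // _; rewrite integral0.
apply: ae_eq_integral => //.
- by apply: (measurableT_comp (measurable_int _ igPA)); exact: measurable_pair1.
- by case: (c \in A) => //; exact: measurable_cst.
exists N; split=> // t /= tP; apply: contrapT => Nt; apply: tP => _.
by rewrite patchE /=; congr (if _ then _ else _); apply/idP/idP; rewrite !inE/= FP.
Qed.
End disintegration.

End disintegrations.

(** The measure on [S] obtained by sending [m * (g m)] through
    [T : X * X -> S], when for almost every first argument [P v] the map
    [T (P v, _)] already sends [g m] to a measure with density
    [E (Psi (v, _))].  The density of the image is then [E] with respect to the
    measure [r] that [Psi] transports from the parameters. *)
Section xsection_fiber.
Local Open Scope ereal_scope.
Context d1 d2 d3 d4 (X : measurableType d1) (C : measurableType d2)
  (W : measurableType d3) (S : measurableType d4) (R : realType).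
Variables (m : {finite_measure set X -> \bar R}).
Variables (p : {sigma_finite_measure set C -> \bar R}).
Variables (w : {sigma_finite_measure set W -> \bar R}).
Variables (r : {measure set S -> \bar R}).
Variables (P : W -> X) (Psi : W * C -> S) (T : X * X -> S).
Variables (N : set W) (g : X -> \bar R) (E : S -> \bar R).
Hypotheses (mP : measurable_fun setT P) (mPsi : measurable_fun setT Psi)
  (mT : measurable_fun setT T).
Hypothesis mE : forall A, measurable A -> m A = w (P @^-1` A).
Hypothesis rE : forall A, measurable A -> r A = (w \x p) (Psi @^-1` A).
Hypotheses (mN : measurable N) (wN : w N = 0).
Hypotheses (ig : m.-integrable setT g) (iE : r.-integrable setT E).
Hypothesis fiber : forall v A, ~ N v -> measurable A ->
  \int[m]_(x in [set x | A (T (P v, x))]) g x =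
  \int[p]_(c in [set c | A (Psi (v, c))]) E (Psi (v, c)).

Lemma integral_xsection_fiber A : measurable A ->
  m.-integrable setT (fun y => \int[m]_(x in xsection (T @^-1` A) y) g x) /\
  \int[m]_y \int[m]_(x in xsection (T @^-1` A) y) g x = \int[r]_(s in A) E s.
Proof.
move=> mA.
have mg := measurable_int _ ig.
have mTA : measurable (T @^-1` A).
  by rewrite -[X in measurable X]setTI; exact: mT.
pose K := (fun z => g z.2) \_ (T @^-1` A).
have iK : (m \x m).-integrable setT K.
  have ig2 : (m \x m).-integrable setT (fun z => g z.2).
    have mg2 : measurable_fun setT (fun z : X * X => g z.2).
      exact: measurableT_comp mg measurable_snd.
    apply/(@integrable12ltyP _ _ _ _ _ m m _ mg2) => /=.
    rewrite integral_cst//; move/integrableP : ig => [_ gfin].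
    have := fin_num_measure m setT measurableT.
    rewrite ge0_fin_numE// => mfin.
    have intg0 : 0 <= \int[m]_x `|g x| by exact: integral_ge0.
    by rewrite lte_mul_pinfty// ge0_fin_numE.
  by apply/(integrable_mkcond _ mTA).1; exact: integrableS ig2.
have -> : (fun y => \int[m]_(x in xsection (T @^-1` A) y) g x) = fubini_F m K.
  apply/funext => y; rewrite integral_mkcond.
  apply: eq_integral => x _; rewrite /K !patchE.
  by congr (if _ then _ else _); apply/idP/idP; rewrite !inE/= /xsection/= inE.
have iH := integrable_fubini_F iK; split=> //.
rewrite (integral_transport mP mE iH measurableT) preimage_setT.
have iEA : r.-integrable setT (E \_ A).
  by apply/(integrable_mkcond _ mA).1; exact: integrableS iE.
have iEP := integrable_transport mPsi rE iEA.
have iG := integrable_fubini_F iEP.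
rewrite [RHS]integral_mkcond (integral_transport mPsi rE iEA measurableT).
rewrite preimage_setT -(integral12_prod_meas1 iEP).
apply: ae_eq_integral => //.
- exact: measurableT_comp (measurable_int _ iH) mP.
- exact: measurable_int iG.
exists N; split=> // v vP; apply: contrapT => Nv; apply: vP => _.
have := fiber Nv mA; rewrite integral_mkcond [in RHS]integral_mkcond.
rewrite /fubini_F => fib; apply: etrans (etrans fib _).
  apply: eq_integral => x _; rewrite /K !patchE.
  by congr (if _ then _ else _); apply/idP/idP; rewrite !inE.
apply: eq_integral => c _; rewrite !patchE.
by rewrite /= patchE; congr (if _ then _ else _); apply/idP/idP; rewrite !inE.
Qed.
End xsection_fiber.

Section fiber_integrable.
Local Open Scope ereal_scope.
Context d2 d3 d4 d5 (C : measurableType d2)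
  (W : measurableType d3) (S : measurableType d4) (I : measurableType d5)
  (R : realType).
Variables (p : {sigma_finite_measure set C -> \bar R}).
Variables (w : {finite_measure set W -> \bar R}).
Variables (r : {sigma_finite_measure set S -> \bar R}).
Variables (q : {sigma_finite_measure set I -> \bar R}).
Variables (Psi : W * C -> S) (L : S * I -> \bar R) (M : R).
Hypotheses (mPsi : measurable_fun setT Psi) (mL : measurable_fun setT L).
Hypothesis rE : forall A, measurable A -> r A = (w \x p) (Psi @^-1` A).
Hypothesis fiberM : forall v, \int[p]_c \int[q]_t `|L (Psi (v, c), t)| = M%:E.

(** Tonelli's theorem: all the maps [Psi (v, _)] see the same finite total mass
    [M], and the mass of the parameters [v] is finite. *)
Lemma integrable_fiber_map :
  r.-integrable setT (fun s => \int[q]_t L (s, t)).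
Proof.
suff iL : (r \x q).-integrable setT L by exact: integrable_fubini_F iL.
apply/(@integrable12ltyP _ _ _ _ _ r q _ mL).
have mLa : measurable_fun setT (fun s => \int[q]_t `|L (s, t)|).
  apply: (measurable_fun_fubini_tonelli_F (abse \o L)) => [|x]; last exact: abse_ge0.
  exact: measurableT_comp.
rewrite [X in X < _](_ : _ = M%:E * w setT).
  by have /fineK <- := fin_num_measure w setT measurableT; rewrite -EFinM ltry.
transitivity (\int[pushforward (w \x p) Psi]_s \int[q]_t `|L (s, t)|).
  by apply: eq_measure_integral => A mA _; exact: rE.
rewrite ge0_integral_pushforward//; last by move=> s _; exact: integral_ge0.
rewrite preimage_setT fubini_tonelli1//; last 2 first.
- exact: measurableT_comp mLa mPsi.
- by move=> v; exact: integral_ge0.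
rewrite /fubini_F /=; under eq_integral do rewrite fiberM.
by rewrite integral_cst.
Qed.
End fiber_integrable.

(** * The semicircle transform *)

Section finite_SO3.
Variable R : realType.

(** A name for the product of the measures of the two spherical angles, which
    carries the structure of a finite measure. *)
Definition angle_measure : set (circle R * measurableTypeR R) -> \bar R :=
  (sigma_T R \x @sin_measure R)%E.
HB.instance Definition _ := Measure.on angle_measure.

Let angle_measure_fin : fin_num_fun angle_measure.
Proof. exact: product_fin_num_fun. Qed.
HB.instance Definition _ :=
  @Measure_isFinite.Build _ _ _ angle_measure angle_measure_fin.

Lemma sigma_SO3E A : sigma_SO3 R A = (angle_measure \x sigma_T R)%E (@Psi3 R @^-1` A).
Proof. by []. Qed.

Let sigma_SO3_fin : fin_num_fun (sigma_SO3 R).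
Proof.
move=> A mA; rewrite sigma_SO3E; apply: product_fin_num_fun.
by rewrite -[X in measurable X]setTI; exact: measurable_funP.
Qed.
HB.instance Definition _ := @Measure_isFinite.Build _ _ _ (sigma_SO3 R) sigma_SO3_fin.
End finite_SO3.
Arguments angle_measure R : clear implicits.

Section semicircles.
Local Open Scope ereal_scope.
Context {R : realType}.
Local Notation S2 := (S2 R).
Local Notation SO3 := (SO3 R).
Local Notation circle := (circle R).
Local Notation q := (@sin_measure R).
Local Notation p := (sigma_T R).

(** The colatitudes at which [Phi c t] need not determine [c]; within [[0, pi]]
    they are the two poles. *)
Definition outside_0pi : set (measurableTypeR R) := ~` `]0%R, pi[%classic.

Lemma measurable_outside : measurable outside_0pi.
Proof. exact: measurableC. Qed.

Lemma sin_measure_outside : q outside_0pi = 0.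
Proof.
apply: integral0_eq => t [/= + t0pi].
rewrite /outside_0pi/= !in_itv/= in t0pi *.
case/andP: t0pi; rewrite le_eqVlt => /predU1P[<-|t0]; first by rewrite sin0.
rewrite le_eqVlt => /predU1P[->|tpi]; first by rewrite sinpi.
by rewrite t0 tpi.
Qed.

Lemma rotate_Phi0 (a : circle) b c t :
  rotate (Psi a b (angle 0)) (Phi c t) = rotate (Psi a b c) (Phi (angle 0) t).
Proof.
apply/val_inj => /=; rewrite -!(mulmxA (R3 a *m R2 b)); congr (_ *m _).
apply/matrixP => i j; rewrite ord1 !mxE !big_ord_recl !big_ord0 !mxE.
rewrite !cosT_angle !sinT_angle cos0 sin0.
by case: i => [[|[|[|//]]] ?] /=; ring.
Qed.

Lemma azimuth_rotate_Phi (a : circle) b c t : (0 < t < pi)%R ->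
  azimuth a b (rotate (Psi a b (angle 0)) (Phi c t)) = c.
Proof.
move=> t0pi; rewrite /azimuth -[RHS](azi_Phi c t0pi); congr azi.
apply/val_inj; rewrite [LHS]/= mulmxA.
have := valP (Psi a b (angle 0)); rewrite inE => -[/mulmx1C + _].
by rewrite /= => ->; rewrite mul1mx.
Qed.

(** Spherical coordinates whose polar axis points to [Phi a b]. *)
Definition tilted_Phi (a : circle) (b : R) (z : circle * measurableTypeR R) : S2 :=
  rotate (Psi a b (angle 0)) (Phi2 z).

Lemma measurable_tilted_Phi a b : measurable_fun setT (tilted_Phi a b).
Proof.
exact: measurableT_comp (measurable_rotate _) (@measurable_Phi R).
Qed.

Lemma sigma_S2_tilted_Phi a b A : measurable A ->
  sigma_S2 R A = (p \x q) (tilted_Phi a b @^-1` A).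
Proof. by move=> mA; rewrite -(invariant_preimage (invariant_rotate a b) mA). Qed.

(** The transform without its normalization and with an extended real value, as
    Fubini's theorem delivers it. *)
Definition half_circle_integral (f : S2 -> R) (Q : SO3) : \bar R :=
  \int[q]_t (f (rotate Q (Phi (angle 0) t)))%:E.
Local Notation E := half_circle_integral.

Lemma measurable_rotate_Phi : measurable_fun setT
  (fun z : SO3 * measurableTypeR R => rotate z.1 (Phi (angle 0) z.2)).
Proof.
apply: borel_S2 => i /=; apply: measurable_mulmx => {i} [i j|i j].
  have mij := measurableT_comp (measurable_SO3_coord i j)
    (@measurable_fst _ _ SO3 (measurableTypeR R)).
  exact: mij.
rewrite ord1.
have mPhi := @measurable_fun_Phi R _ (SO3 * measurableTypeR R)%type (cst (angle 0))
  snd (measurable_cst _) measurable_snd.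
exact: measurableT_comp (measurable_S2_coord i) mPhi.
Qed.

Lemma semicircleE f Q : measurable_fun setT f ->
  semicircle f Q = ((4 * pi)^-1 * fine (E f Q))%R.
Proof.
move=> mf; rewrite /semicircle /half_circle_integral integral_sin_measure//.
apply/measurable_EFinP; apply: measurableT_comp mf _.
apply: measurableT_comp (measurable_rotate Q) _.
by apply: measurable_fun_Phi.
Qed.

Lemma semicircle_at_fine a b f c : measurable_fun setT f ->
  semicircle_at a b f c = fine (E f (Psi a b c)).
Proof.
move=> mf; rewrite /semicircle_at semicircleE// mulrA divff ?mul1r//.
by rewrite mulf_neq0// gt_eqF// pi_gt0.
Qed.

Section level_sets.
Variable f : S2 -> R.
Hypothesis intf : (sigma_S2 R).-integrable setT (EFin \o f).

(** Up to the poles, the fibres of [azimuth a b] are the half circles over which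
    [half_circle_integral] integrates, and [tilted_Phi a b] computes the
    surface measure by rotation invariance. *)
Lemma integral_azimuth (a : circle) (b : R) A : measurable A ->
  \int[sigma_S2 R]_(x in azimuth a b @^-1` A) (f x)%:E =
  \int[p]_(c in A) E f (Psi a b c).
Proof.
move=> mA.
rewrite (integral_fiber (measurable_tilted_Phi a b) (@measurable_azimuth R a b)
  (sigma_S2_tilted_Phi a b) measurable_outside sin_measure_outside _ intf mA).
  apply: eq_integral => c _; apply: eq_integral => t _.
  by rewrite /tilted_Phi/= rotate_Phi0.
move=> c t; rewrite /outside_0pi/= => /contrapT; rewrite in_itv/=.
exact: azimuth_rotate_Phi.
Qed.

Lemma integrable_azimuth a b :
  p.-integrable setT (fun c => E f (Psi a b c)).
Proof.
have := integrable_fiber (measurable_tilted_Phi a b) (sigma_S2_tilted_Phi a b) intf.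
apply: eq_integrable => // c _; apply: eq_integral => t _.
by rewrite /tilted_Phi/= rotate_Phi0.
Qed.
End level_sets.

(** By [integral_azimuth] for [|f|], the half-circle integrals of [|f|] over
    the circle [Psi a b _] integrate to the norm of [f], independently of [a]
    and [b]. *)
Lemma integrable_half_circle_integral f :
  (sigma_S2 R).-integrable setT (EFin \o f) ->
  (sigma_SO3 R).-integrable setT (E f).
Proof.
move=> intf.
have mf : measurable_fun setT f.
  by apply/measurable_EFinP; exact: measurable_int intf.
pose L (z : SO3 * measurableTypeR R) := (f (rotate z.1 (Phi (angle 0) z.2)))%:E.
have mL : measurable_fun setT L.
  by apply/measurable_EFinP; exact: measurableT_comp mf measurable_rotate_Phi.
have intaf : (sigma_S2 R).-integrable setT (EFin \o (fun x => `|f x|%R)).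
  exact: integrable_abse intf.
pose M := fine (\int[sigma_S2 R]_x `|f x|%:E).
apply: (@integrable_fiber_map _ _ _ _ _ _ _ _ _ p (angle_measure R) (sigma_SO3 R) q
  (@Psi3 R) L M (@measurable_Psi R) mL) => [A mA|v]; first by [].
rewrite /M fineK; last exact: (integrable_fin_num measurableT intaf).
by have /= := integral_azimuth intaf v.1 v.2 measurableT; rewrite preimage_setT => ->.
Qed.

Lemma pol_Phi (a : circle) b : (0 < b < pi)%R -> pol (Phi a b) = b.
Proof.
by move=> /andP[b0 bpi]; rewrite /pol mxE/= cosK// in_itv/= !ltW.
Qed.

(** For almost every [(a, b)] the map [x |-> T_W (Phi a b, x)] is
    [Psi a b] after [azimuth a b], so [integral_azimuth] describes its effect on
    [f sigma]; what remains is the integral over [(a, b)].  The factor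
    comes from the normalization of [u_S2]. *)
Lemma semicircle_measE f (intf : (sigma_S2 R).-integrable setT (EFin \o f)) A :
  measurable A ->
  semicircle_meas (induced_charge intf) A =
  ((4 * pi)^-1)%:E * \int[sigma_SO3 R]_(Q in A) E f Q.
Proof.
move=> mA.
have mN : measurable ([set: circle] `*` outside_0pi).
  by apply: measurableX => //; exact: measurable_outside.
have wN : angle_measure R ([set: circle] `*` outside_0pi) = 0.
  rewrite /angle_measure product_measure1E//; last exact: measurable_outside.
  rewrite -[RHS](mule0 (p setT)); congr (_ * _).
  exact: sin_measure_outside.
have [|iH HE] := @integral_xsection_fiber _ _ _ _ S2 circle
    (circle * measurableTypeR R)%type SO3 R (sigma_S2 R) p (angle_measure R)
    (sigma_SO3 R) (@Phi2 R) (@Psi3 R) (@T_W R) _ (EFin \o f) (E f)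
    (@measurable_Phi R) (@measurable_Psi R) (@measurable_T_W R)
    (fun A mA => erefl) (fun A mA => erefl) mN wN intf
    (integrable_half_circle_integral intf) _ A mA.
  move=> [a b] B Nab mB.
  have b0pi : (0 < b < pi)%R.
    by apply: contrapT => nb; apply: Nab; split=> //; rewrite /outside_0pi/= in_itv/=.
  rewrite /T_W /Phi2 /Psi3/= azi_Phi// pol_Phi//.
  apply: (integral_azimuth intf a b (A := [set c | B (Psi a b c)])).
  have mPsi : measurable_fun setT (fun c : circle => Psi a b c).
    by apply: measurable_fun_Psi.
  by have := mPsi measurableT B mB; rewrite setTI.
transitivity (\int[@u_S2 R]_y
    \int[sigma_S2 R]_(x in xsection (@T_W R @^-1` A) y) (f x)%:E).
  by [].
rewrite -HE; exact: integral_mscale iH.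
Qed.
End semicircles.

Lemma has_density_semicircle (R : realType) (f : S2 R -> R)
    (intf : (sigma_S2 R).-integrable [set: S2 R] (EFin \o f)) :
  has_density (semicircle_meas (induced_charge intf)) (semicircle f) (sigma_SO3 R).
Proof.
have mf : measurable_fun setT f by apply/measurable_EFinP; exact: measurable_int intf.
have iE := integrable_half_circle_integral intf.
have iEf := integrable_fine iE.
have sE : EFin \o semicircle f =
    (fun Q => ((4 * pi)^-1)%:E * (fine (half_circle_integral f Q))%:E)%E.
  by apply/funext => Q; rewrite /= semicircleE// EFinM.
have inth : (sigma_SO3 R).-integrable setT (EFin \o semicircle f).
  by rewrite sE; exact: integrableZl.
exists inth => A mA; apply: etrans (semicircle_measE intf mA) _.
rewrite /induced_charge sE -(integral_fine iE mA); apply/esym/integralZl => //.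
exact: integrableS iEf.
Qed.

Lemma has_density_semicircle_at (R : realType) (f : S2 R -> R)
    (intf : (sigma_S2 R).-integrable [set: S2 R] (EFin \o f)) a b :
  has_density (semicircle_meas_at a b (induced_charge intf))
    (semicircle_at a b f) (sigma_T R).
Proof.
have mf : measurable_fun setT f by apply/measurable_EFinP; exact: measurable_int intf.
have iE := integrable_azimuth intf a b.
have sE : EFin \o semicircle_at a b f =
    (fun c => (fine (half_circle_integral f (Psi a b c)))%:E).
  by apply/funext => c; rewrite /= semicircle_at_fine.
have inth : (sigma_T R).-integrable setT (EFin \o semicircle_at a b f).
  by rewrite sE; exact: integrable_fine.
exists inth => A mA; rewrite /induced_charge sE integral_fine//.
exact: integral_azimuth.
Qed.

Theorem proposition4p9 (R : realType) (f : S2 R -> R)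
    (intf : (sigma_S2 R).-integrable [set: S2 R] (EFin \o f)) :
  [/\ has_density (semicircle_meas (induced_charge intf))
        (semicircle f) (sigma_SO3 R),
      forall (alpha : circle R) (beta : R), 0 <= beta <= pi ->
        has_density (semicircle_meas_at alpha beta (induced_charge intf))
          (semicircle_at alpha beta f) (sigma_T R),
      semicircle_meas (induced_charge intf) `<< sigma_SO3 R &
      forall (alpha : circle R) (beta : R), 0 <= beta <= pi ->
        semicircle_meas_at alpha beta (induced_charge intf) `<< sigma_T R].
Proof.
split=> [|a b _||a b _].
- exact: has_density_semicircle.
- exact: has_density_semicircle_at.
- exact: has_density_dominates (has_density_semicircle _).
- exact: has_density_dominates (has_density_semicircle_at _ a b).
Qed.
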